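(* Let $1\le r<1+\alpha\le2$. Let $\phi,\tilde\phi\in C^{1,\alpha}_b$ be bounded in the sense that, for $\psi=\phi$ and $\psi=\tilde\phi$, $$\|\psi\|_{\sup}\le\Phi_0,\quad \|\psi\|_{C^\alpha}\le\Phi_\alpha,\quad \|D\psi\|_{\sup}\le\Phi_1,\quad\|D\psi\|_{C^\alpha}\le\Phi_{1,\alpha}.$$ Let $Y,\tilde Y$ be solutions to the Young equations $dY_t=\phi(Y_t)\,dX_t$ and $d\tilde Y_t=\tilde\phi(\tilde Y_t)\,d\tilde X_t$ with $X,\tilde X\in V^r$ and initial data $y_0,\tilde y_0$. Then, for small enough $T>0$ and all intervals $I\subset[0,T]$, we have $$V^r\Delta Y_I\le\gamma\,V^rX_I+2\Phi_0\,V^r\Delta X_I$$ with \begin{align*} \gamma\lesssim{}&\big((C_{\mathrm{sew}}+1)\Phi_1+C_{\mathrm{sew}}2^{\alpha+1}\Phi_{1,\alpha}\Phi_0^\alpha\epsilon^\alpha\big)\Phi_0\,V^r\Delta X_{[0,T]}+\big(C_{\mathrm{sew}}2^{\alpha+1}\Phi_{1,\alpha}\Phi_0^\alpha\epsilon^\alpha+\Phi_1\big)|y_0-\tilde y_0|\\ &+\Phi_0^{1-\alpha}\|\Delta\phi\|_{C^\alpha}+\|\Delta\phi\|_{\sup}. \end{align*}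
   Context: $\lesssim$ denotes inequality up to a multiplicative constant. Put $\theta=(1+\alpha)/r$, $\zeta(\theta)=\sum_{k\ge1}k^{-\theta}$ and $C_{\mathrm{sew}}=2^{\theta-1}\zeta(\theta)$. The number $\epsilon>0$ satisfies $$2^{\alpha+\theta-1}\zeta(\theta)\Phi_\alpha\epsilon^\alpha\le\Phi_0^{1-\alpha},\qquad 2^{\theta-1}\zeta(\theta)\Phi_1\epsilon\le\tfrac18,\qquad 2^{\theta-1}\zeta(\theta)2^\alpha\Phi_0^\alpha\frac{\Phi_{1,\alpha}}{1+\alpha}\epsilon^{1+\alpha}\le\tfrac18,$$ and ''$T$ small enough'' means that $V^rX_{[0,T]}<\epsilon$ and $V^r\tilde X_{[0,T]}<\epsilon$. $\Phi_0,\Phi_\alpha,\Phi_1,\Phi_{1,\alpha}>0$ are constants. $X,\tilde X$ are $\mathbb R^n$-valued paths, $Y,\tilde Y$ are $\mathbb R^d$-valued, and $\phi,\tilde\phi:\mathbb R^d\to L(\mathbb R^n,\mathbb R^d)$. For a path $f$ write $f_{s,t}=f_t-f_s$ and, for an interval $I\subset[0,T]$, $V^rf_I=\sup_\pi(\sum_i|f_{\pi_i,\pi_{i+1}}|^r)^{1/r}$, supremum over finite increasing sequences $\pi\subset I$; $f\in V^r$ means $V^rf_{[0,T]}<\infty$. $\|\psi\|_{C^\alpha}=\sup_{x\ne y}|\psi(x)-\psi(y)|/|x-y|^\alpha$ is the Hölder seminorm; $C^{1,\alpha}_b$ is the space of bounded differentiable functions with bounded derivative and $\|D\psi\|_{C^\alpha}<\infty$.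 Differences: $\Delta Y=Y-\tilde Y$, $\Delta X=X-\tilde X$, $\Delta\phi=\phi-\tilde\phi$. The equations mean $Y_t=y_0+\int_0^t\phi(Y_s)\,dX_s$, $\tilde Y_t=\tilde y_0+\int_0^t\tilde\phi(\tilde Y_s)\,d\tilde X_s$, where the Young integral $\int_0^t\phi(Y)\,dX$ is the limit over finite partitions $\pi$ of $[0,t]$ (directed by refinement) of $\sum_j\phi(Y_{\pi_j})X_{\pi_j,\pi_{j+1}}$. *)

(* Defs.v *)
From HB Require Import structures.
From mathcomp Require Import all_boot all_order all_algebra.
From mathcomp Require Import all_classical all_reals all_analysis.

Set Implicit Arguments.
Unset Strict Implicit.
Unset Printing Implicit Defensive.

Import Order.TTheory GRing.Theory Num.Theory.
Import numFieldNormedType.Exports.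

Local Open Scope classical_set_scope.
Local Open Scope ring_scope.

(* R^n is 'cV[R]_n and L(R^n, R^d) is 'M[R]_(d, n), acting by A *m x.  The
   library norm `|x| on matrices is the max norm; the Euclidean norm and the
   operator norms it induces are used instead.  The topology, hence limits and
   differentials, is the same. *)

Definition enorm (R : realType) (n : nat) (x : 'cV[R]_n) : R :=
  Num.sqrt (\sum_i x i ord0 ^+ 2).

Definition opnorm (R : realType) (U V : Type) (normU : U -> R) (normV : V -> R)
    (f : U -> V) : R :=
  sup [set normV (f u) | u in [set u | normU u <= 1]].

Definition mnorm (R : realType) (d n : nat) (A : 'M[R]_(d, n)) : R :=
  opnorm (@enorm R n) (@enorm R d) (mulmx A).

Definition dnorm (R : realType) (d n : nat) (L : 'cV[R]_d -> 'M[R]_(d, n)) : R :=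
  opnorm (@enorm R d) (@mnorm R d n) L.

Definition supnorm (R : realType) (U V : Type) (normV : V -> R) (psi : U -> V)
    : \bar R :=
  ereal_sup [set (normV (psi x))%:E | x in setT].

(* Pairs x = y are included and contribute 0 / 0 = 0: this only matters on a
   one-point space (R^0), where the supremum would otherwise be -oo. *)
Definition holder (R : realType) (d : nat) (V : zmodType) (normV : V -> R)
    (alpha : R) (psi : 'cV[R]_d -> V) : \bar R :=
  ereal_sup [set (normV (psi p.1 - psi p.2) / (enorm (p.1 - p.2) `^ alpha))%:E
            | p in [set: 'cV[R]_d * 'cV[R]_d]].

Definition Dfun (R : realType) (d n : nat) (psi : 'cV[R]_d -> 'M[R]_(d, n))
    (x : 'cV[R]_d) : 'cV[R]_d -> 'M[R]_(d, n) := 'd psi x.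

Definition C1alpha_b (R : realType) (d n : nat) (alpha : R)
    (psi : 'cV[R]_d -> 'M[R]_(d, n)) : Prop :=
  [/\ forall x, differentiable psi x,
      (supnorm (@mnorm R d n) psi < +oo)%E,
      (supnorm (@dnorm R d n) (Dfun psi) < +oo)%E &
      (holder (@dnorm R d n) alpha (Dfun psi) < +oo)%E].

Definition C1alpha_bounds (R : realType) (d n : nat)
    (alpha Phi0 Phia Phi1 Phi1a : R) (psi : 'cV[R]_d -> 'M[R]_(d, n)) : Prop :=
  [/\ (supnorm (@mnorm R d n) psi <= Phi0%:E)%E,
      (holder (@mnorm R d n) alpha psi <= Phia%:E)%E,
      (supnorm (@dnorm R d n) (Dfun psi) <= Phi1%:E)%E &
      (holder (@dnorm R d n) alpha (Dfun psi) <= Phi1a%:E)%E].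

Definition pvar (R : realType) (n : nat) (r : R) (f : R -> 'cV[R]_n) (I : set R)
    : \bar R :=
  ereal_sup [set ((\sum_(i < (size s).-1)
                     enorm (f s`_i.+1 - f s`_i) `^ r) `^ r^-1)%:E
            | s in [set s : seq R | sorted <%R s /\ [set` s] `<=` I]].

(* As in [itv_partition], the seq s stands for the partition a :: s of [a, b]. *)
Definition young_sum (R : realType) (d n : nat) (A : R -> 'M[R]_(d, n))
    (X : R -> 'cV[R]_n) (a : R) (s : seq R) : 'cV[R]_d :=
  \sum_(i < size s)
    A (a :: s)`_i *m (X (a :: s)`_i.+1 - X (a :: s)`_i).

(* The filter of sections of the partitions of [a, b] directed by refinement. *)
Definition refinement (R : realType) (a b : R) : set_system (seq R) :=
  filter_from (itv_partition a b)
    (fun s => [set s' | itv_partition a b s' /\ {subset s <= s'}]).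

Definition is_young_integral (R : realType) (d n : nat) (A : R -> 'M[R]_(d, n))
    (X : R -> 'cV[R]_n) (a b : R) (v : 'cV[R]_d) : Prop :=
  young_sum A X a s @[s --> refinement a b] --> v.

Definition young_solution (R : realType) (d n : nat)
    (phi : 'cV[R]_d -> 'M[R]_(d, n)) (X : R -> 'cV[R]_n) (y0 : 'cV[R]_d) (T : R)
    (Y : R -> 'cV[R]_d) : Prop :=
  forall t, 0 <= t <= T -> is_young_integral (phi \o Y) X 0 t (Y t - y0).

Definition theta (R : realType) (alpha r : R) : R := (1 + alpha) / r.

(* riemannR s k = 1 / (k + 1) ^ s *)
Definition zeta (R : realType) (s : R) : R := limn (series (riemannR s)).

Definition Csew (R : realType) (alpha r : R) : R :=
  2 `^ (theta alpha r - 1) * zeta (theta alpha r).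

(* Main.v *)
Require Import Defs.
From HB Require Import structures.
From mathcomp Require Import all_boot all_order all_algebra.
From mathcomp Require Import all_classical all_reals all_analysis.
From mathcomp Require Import ring lra.

Set Implicit Arguments.
Unset Strict Implicit.
Unset Printing Implicit Defensive.

Import Order.TTheory GRing.Theory Num.Theory.
Import numFieldNormedType.Exports.

Local Open Scope classical_set_scope.
Local Open Scope ring_scope.

(** Two facts about the Young integral of [A] against [X] carry the proof.

    The first is Young's inequality: on [[u, v]] the integral is at most
    [(|A u| + zeta(theta) KA) KX] as soon as [A] has [r/alpha]-variation at most
    [KA] and [X] has [r]-variation at most [KX] ([discrete_young] for Riemann
    sums, [young_integral_bound] in the limit).  It is proved by removing the
    points of a partition one by one.  When [N] interior points are left,
    Hoelder's inequality shows that one of them costs at most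
    [N^-theta KA KX], and these costs add up to [zeta(theta)].

    The second is that a solution has finite [r]-variation, although the
    equation only says that Riemann sums converge to [Y t - y0] for each [t].
    As in the Saks-Henstock lemma, convergence along refinements controls not
    only the sum of the remainders [(Y v - Y u) - A u (X v - X u)] over a fine
    partition but also the sum over any part of its cells, hence the sum of
    their norms ([bounded_remainder_sums], [solution_finite_variation]).  This
    makes it legitimate to move multiples of [V^r Y] and [V^r (Y - Y')] to the
    other side of an inequality.

    Write [V f] for the [r]-variation of [f] on [[0, T]].  Young's inequality
    for [A = phi o Y] gives [V Y <= (Phi0 + zeta Phia (V Y)^alpha) eps], and the
    first smallness condition turns this into [V Y <= 2 Phi0 eps]; the same
    holds for [Y'] ([solution_variation_bound]).  For the difference, write

      [phi(Y) dX - phi'(Y') dX'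
         = (phi(Y) - phi(Y')) dX + (phi - phi')(Y') dX + phi'(Y') d(X - X')].

    The last term contributes at most [2 Phi0 V(X - X')], again by the first
    smallness condition, and the second one is controlled by the norms of
    [phi - phi'].  For the first term, the increments of [phi(Y) - phi(Y')] are
    second-order differences of [phi]; by the mean value theorem they are at
    most [Phi1 |increment of Y - Y'| + Phi1a |increments of Y, Y'|^alpha
    sup |Y - Y'|] ([four_point_bound]).  Altogether the increments of [Y - Y']
    are at most [gamma V X + 2 Phi0 V(X - X')] on each subinterval, where
    [gamma] is affine in [W = V(Y - Y')] ([difference_variation_bound]).  Taking
    the interval [[0, T]] bounds [W] by [gamma eps + 2 Phi0 V(X - X')]; the other
    two smallness conditions make the coefficient of [W] in [gamma], times [eps],
    at most [3/4], so that [gamma] can be solved for ([difference_rate_bound]). *)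

(** * Finite sums of powers *)

Lemma ler_powRl (R : realType) (p x y : R) :
  0 <= p -> 0 <= x -> x <= y -> x `^ p <= y `^ p.
Proof.
by move=> p0 x0 xy; apply: ge0_ler_powR; rewrite // nnegrE// (le_trans x0).
Qed.

Lemma powRK (R : realType) (p x : R) : p != 0 -> 0 <= x -> (x `^ p) `^ p^-1 = x.
Proof. by move=> p0 x0; rewrite -powRrM mulfV// powRr1. Qed.

Lemma powRVK (R : realType) (p x : R) : p != 0 -> 0 <= x -> (x `^ p^-1) `^ p = x.
Proof. by move=> p0 x0; rewrite -powRrM mulVf// powRr1. Qed.

Lemma ler_powR2r (R : realType) (p x y : R) :
  0 < p -> 0 <= x -> 0 <= y -> x `^ p <= y `^ p -> x <= y.
Proof.
move=> p0 x0 y0 xy; rewrite -[x](@powRK _ p)// ?gt_eqF// -[y](@powRK _ p)// ?gt_eqF//.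
by apply: ler_powRl => //; rewrite ?invr_ge0 ?powR_ge0// ltW.
Qed.

(** Hoelder's inequality, with the exponents put on the outside: weighted
    arithmetic-geometric mean for the sequences normalised to have sum 1. *)
Lemma sum_geom_mean_le (R : realType) (I : Type) (r : seq I) (a b : I -> R)
    (lam mu : R) :
  0 < lam -> 0 < mu -> lam + mu = 1 ->
  (forall i, 0 <= a i) -> (forall i, 0 <= b i) ->
  \sum_(i <- r) a i `^ lam * b i `^ mu
    <= (\sum_(i <- r) a i) `^ lam * (\sum_(i <- r) b i) `^ mu.
Proof.
move=> l0 m0 lm a0 b0; set A := \sum_(i <- r) a i; set B := \sum_(i <- r) b i.
have A0 : 0 <= A by apply: sumr_ge0 => i _.
have B0 : 0 <= B by apply: sumr_ge0 => i _.
have key i : (A != 0) -> (B != 0) -> a i `^ lam * b i `^ mu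
    <= A `^ lam * B `^ mu * (lam * (a i / A) + mu * (b i / B)).
  move=> An Bn.
  have -> : a i `^ lam * b i `^ mu =
      A `^ lam * B `^ mu * ((a i / A) `^ lam * (b i / B) `^ mu).
    have e1 : a i `^ lam = A `^ lam * (a i / A) `^ lam.
      by rewrite -powRM ?divr_ge0// mulrC divfK.
    have e2 : b i `^ mu = B `^ mu * (b i / B) `^ mu.
      by rewrite -powRM ?divr_ge0// mulrC divfK.
    by rewrite {1}e1 {1}e2 mulrACA.
  rewrite ler_wpM2l ?mulr_ge0 ?powR_ge0//.
  have := @conjugate_powR R ((a i / A) `^ lam) ((b i / B) `^ mu) lam^-1 mu^-1.
  rewrite !invrK !powR_ge0 !invr_gt0 => /(_ isT isT l0 m0 lm).
  rewrite !powRK ?divr_ge0 ?gt_eqF//.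
  by rewrite [_ * lam]mulrC [_ * mu]mulrC.
have [Ae|An] := eqVneq A 0.
  have Z : \sum_(i <- r) a i `^ lam * b i `^ mu = 0.
    move: Ae; rewrite /A; elim: (r) => [|x l IH]; first by rewrite !big_nil.
    rewrite !big_cons => /eqP; rewrite paddr_eq0 ?sumr_ge0//.
    by move=> /andP[/eqP-> /eqP/IH->]; rewrite powR0 ?gt_eqF// mul0r addr0.
  by rewrite Z mulr_ge0 ?powR_ge0.
have [Be|Bn] := eqVneq B 0.
  have Z : \sum_(i <- r) a i `^ lam * b i `^ mu = 0.
    move: Be; rewrite /B; elim: (r) => [|x l IH]; first by rewrite !big_nil.
    rewrite !big_cons => /eqP; rewrite paddr_eq0 ?sumr_ge0//.
    by move=> /andP[/eqP-> /eqP/IH->]; rewrite powR0 ?gt_eqF// mulr0 addr0.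
  by rewrite Z mulr_ge0 ?powR_ge0.
apply: le_trans (ler_sum _ (fun i _ => key i An Bn)) _.
rewrite -mulr_sumr big_split/= -!mulr_sumr -!mulr_suml -/A -/B !mulfV//.
by rewrite !mulr1 lm mulr1.
Qed.

(** By Hoelder's inequality the average of the weighted geometric means is at
    most the right-hand side, so some term is. *)
Lemma exists_geom_mean_le (R : realType) (n : nat) (a b : 'I_n.+1 -> R)
    (lam mu : R) :
  0 < lam -> 0 < mu -> lam + mu = 1 ->
  (forall i, 0 <= a i) -> (forall i, 0 <= b i) ->
  exists i, a i `^ lam * b i `^ mu
    <= (\sum_i a i) `^ lam * (\sum_i b i) `^ mu / n.+1%:R.
Proof.
move=> l0 m0 lm a0 b0; apply: contrapT => /forallNP H.
have := sum_geom_mean_le (index_enum 'I_n.+1) l0 m0 lm a0 b0.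
apply/negP; rewrite -ltNge.
set K := (X in X < _).
have -> : K = \sum_(i < n.+1) K / n.+1%:R.
  by rewrite sumr_const card_ord -[RHS]mulr_natr divfK// pnatr_eq0.
apply: ltr_sum => [|i _].
  by apply/hasP; exists ord0; rewrite ?mem_index_enum.
by rewrite ltNge; apply/negP/H.
Qed.

(** Minkowski's inequality, with explicit bounds [A] and [B] in place of the
    norms.  It is convexity of the power applied to [a i / A] and [b i / B]
    with weights [A / (A + B)] and [B / (A + B)]. *)
Lemma sum_powR_minkowski (R : realType) (I : Type) (r : seq I) (a b : I -> R)
    (p A B : R) :
  1 <= p -> 0 <= A -> 0 <= B ->
  (forall i, 0 <= a i) -> (forall i, 0 <= b i) ->
  \sum_(i <- r) a i `^ p <= A `^ p -> \sum_(i <- r) b i `^ p <= B `^ p ->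
  \sum_(i <- r) (a i + b i) `^ p <= (A + B) `^ p.
Proof.
move=> p1; have p0 : 0 < p by exact: lt_le_trans p1.
move=> A0 B0 a0 b0 hA hB.
have zero (c d : I -> R) (D : R) : (forall i, 0 <= c i) ->
    \sum_(i <- r) c i `^ p <= 0 `^ p ->
    \sum_(i <- r) d i `^ p <= D `^ p ->
    \sum_(i <- r) (c i + d i) `^ p <= D `^ p.
  move=> c0; rewrite powR0 ?gt_eqF// => hc; apply: le_trans.
  elim: (r) hc => [|x l IH]; first by rewrite !big_nil.
  rewrite !big_cons => hc.
  have s0 : 0 <= \sum_(j <- l) c j `^ p by apply: sumr_ge0 => ? _; exact: powR_ge0.
  have cx0 := powR_ge0 (c x) p.
  have cx : c x = 0 by apply: (@powR_eq0_eq0 _ _ p); lra.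
  rewrite cx add0r lerD2l; apply: IH; lra.
move: A0; rewrite le_eqVlt => /predU1P[A0|A0].
  by move: hA; rewrite -A0 add0r => hA; exact: zero.
move: B0; rewrite le_eqVlt => /predU1P[B0|B0].
  move: hB; rewrite -B0 addr0 => hB; under eq_bigr do rewrite addrC.
  exact: zero.
have AB0 : 0 < A + B by exact: addr_gt0.
have t01 : (0 <= A / (A + B) <= 1).
  by rewrite divr_ge0 ?(ltW A0) ?(ltW AB0)//= ler_pdivrMr// mul1r lerDl ltW.
have key i : (a i + b i) `^ p <= (A + B) `^ p *
    (A / (A + B) * (a i `^ p / A `^ p) + (1 - A / (A + B)) * (b i `^ p / B `^ p)).
  have -> : a i + b i =
      (A + B) * (A / (A + B) * (a i / A) + (1 - A / (A + B)) * (b i / B)).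
    by field; apply/and3P; split; apply: lt0r_neq0.
  have x0 : 0 <= a i / A by apply: divr_ge0; rewrite // ltW.
  have y0 : 0 <= b i / B by apply: divr_ge0; rewrite // ltW.
  have e c C : 0 <= c -> 0 < C -> c `^ p / C `^ p = (c / C) `^ p.
    move=> c0 C0; rewrite -[in LHS](@divfK _ C _ c) ?gt_eqF//.
    by rewrite powRM ?divr_ge0// ?ltW// mulfK// gt_eqF// powR_gt0.
  case/andP: t01 => t0 t1.
  rewrite powRM ?(ltW AB0)//; last by rewrite addr_ge0// mulr_ge0// subr_ge0.
  rewrite ler_wpM2l ?powR_ge0// !e//.
  have /(_ (Itv01 t0 t1) (a i / A) (b i / B)) := convex_powR p1.
  rewrite !inE/= !in_itv/= !andbT => /(_ x0 y0).
  by rewrite !convRE.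
apply: le_trans (ler_sum _ (fun i _ => key i)) _.
rewrite -mulr_sumr big_split/= -!mulr_sumr -!mulr_suml.
rewrite -[leRHS]mulr1 ler_wpM2l ?powR_ge0//.
case/andP: t01 => t0 t1.
rewrite -[leRHS](subrKC (A / (A + B)) 1) lerD//.
  by rewrite ler_piMr// ler_pdivrMr ?powR_gt0// mul1r.
by rewrite ler_piMr ?subr_ge0// ler_pdivrMr ?powR_gt0// mul1r.
Qed.

(** The norm of [l^p] decreases in [p]: each [a i] is at most [K], so that
    [a i ^ q <= a i ^ p K ^ (q - p)]. *)
Lemma sum_powR_le_powR (R : realType) (I : Type) (r : seq I) (a : I -> R)
    (p q K : R) :
  0 < p -> p <= q -> 0 <= K -> (forall i, 0 <= a i) ->
  \sum_(i <- r) a i `^ p <= K `^ p -> \sum_(i <- r) a i `^ q <= K `^ q.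
Proof.
move=> p0 pq K0 a0 h.
have q0 : 0 < q by exact: lt_le_trans pq.
have split x : 0 <= x -> x `^ q = x `^ p * x `^ (q - p).
  rewrite le_eqVlt => /predU1P[<-|x0]; first by rewrite (powR0 (lt0r_neq0 q0)) (powR0 (lt0r_neq0 p0)) mul0r.
  by rewrite -powRD; [rewrite subrKC|rewrite (gt_eqF x0) implybT].
suff H : \sum_(i <- r) a i `^ q <= (\sum_(i <- r) a i `^ p) * K `^ (q - p).
  by rewrite (le_trans H)// (split K)// ler_wpM2r ?powR_ge0.
have qp : 0 <= q - p by rewrite subr_ge0.
elim: r h => [|x l IH]; first by rewrite !big_nil mul0r.
rewrite !big_cons mulrDl => h.
have s0 : 0 <= \sum_(j <- l) a j `^ p by apply: sumr_ge0 => ? _; exact: powR_ge0.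
have ax0 := powR_ge0 (a x) p.
apply: lerD; last by apply: IH; lra.
rewrite split// ler_wpM2l// ler_powRl// (@ler_powR2r _ p)//; lra.
Qed.
(** * Euclidean and operator norms *)

Section EuclideanNorm.
Context {R : realType}.

Lemma enorm_ge0 n (x : 'cV[R]_n) : 0 <= enorm x.
Proof. exact: sqrtr_ge0. Qed.

Lemma enorm_sqr n (x : 'cV[R]_n) : enorm x ^+ 2 = \sum_i x i ord0 ^+ 2.
Proof. by rewrite sqr_sqrtr// sumr_ge0// => i _; exact: sqr_ge0. Qed.

Lemma enormZ n c (x : 'cV[R]_n) : enorm (c *: x) = `|c| * enorm x.
Proof.
rewrite /enorm; under eq_bigr do rewrite mxE exprMn.
by rewrite -mulr_sumr sqrtrM ?sqr_ge0// sqrtr_sqr.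
Qed.

Lemma enorm0 n : enorm (0 : 'cV[R]_n) = 0.
Proof. by rewrite -(scale0r (0 : 'cV[R]_n)) enormZ normr0 mul0r. Qed.

Lemma enormN n (x : 'cV[R]_n) : enorm (- x) = enorm x.
Proof. by rewrite -scaleN1r enormZ normrN1 mul1r. Qed.

Lemma ler_coord_enorm n (x : 'cV[R]_n) i : `|x i ord0| <= enorm x.
Proof.
rewrite -ler_sqr ?nnegrE ?enorm_ge0// enorm_sqr real_normK ?num_real//.
by rewrite (bigD1 i)//= lerDl sumr_ge0// => j _; exact: sqr_ge0.
Qed.

Lemma enorm0_eq0 n (x : 'cV[R]_n) : enorm x = 0 -> x = 0.
Proof.
move=> x0; apply/matrixP => i j; rewrite ord1 mxE; apply/eqP.
by rewrite -normr_le0 -x0 ler_coord_enorm.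
Qed.

Lemma enormD n (x y : 'cV[R]_n) : enorm (x + y) <= enorm x + enorm y.
Proof.
have E (a : R) : 0 <= a -> a `^ 2 = a ^+ 2 by move=> a0; rewrite powR_mulrn.
have S (z : 'cV[R]_n) : \sum_i `|z i ord0| `^ 2 = enorm z ^+ 2.
  rewrite enorm_sqr; apply: eq_bigr => i _.
  by rewrite E// real_normK ?num_real.
rewrite -ler_sqr ?nnegrE ?addr_ge0 ?enorm_ge0// enorm_sqr.
rewrite -E ?addr_ge0 ?enorm_ge0//.
apply: le_trans (@sum_powR_minkowski R _ _ (fun i => `|x i ord0|)
  (fun i => `|y i ord0|) 2 _ _ _ _ _ _ _ _ _); rewrite ?enorm_ge0 ?ler1n//.
- apply: ler_sum => i _; rewrite E ?addr_ge0// mxE -real_normK ?num_real//.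
  by rewrite ler_sqr ?nnegrE ?addr_ge0// ler_normD.
- by rewrite S E ?enorm_ge0.
- by rewrite S E ?enorm_ge0.
Qed.

Lemma enorm_sum n (I : Type) (r : seq I) (F : I -> 'cV[R]_n) :
  enorm (\sum_(i <- r) F i) <= \sum_(i <- r) enorm (F i).
Proof.
elim: r => [|i r IH]; first by rewrite !big_nil enorm0.
by rewrite !big_cons (le_trans (enormD _ _))// lerD2l.
Qed.

Lemma enorm_le_sum n (x : 'cV[R]_n) : enorm x <= \sum_i `|x i ord0|.
Proof.
have s0 : 0 <= \sum_i `|x i ord0| by exact: sumr_ge0.
rewrite -ler_sqr ?nnegrE ?enorm_ge0// enorm_sqr.
have := @sum_powR_le_powR R _ (index_enum 'I_n) (fun i => `|x i ord0|) 1 2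
  (\sum_i `|x i ord0|) ltr01 _ s0 (fun i => normr_ge0 _).
rewrite powRr1//; under eq_bigr do rewrite powRr1//.
rewrite ler1n powR_mulrn// => /(_ isT (lexx _)); apply: le_trans.
apply: ler_sum => i _; rewrite powR_mulrn// real_normK ?num_real//.
Qed.

(** Limits are taken for the maximum norm of matrices; this is how they give
    limits for the Euclidean norm. *)
Lemma enorm_le_mx_norm n (x : 'cV[R]_n) : enorm x <= n%:R * `|x|.
Proof.
apply: le_trans (enorm_le_sum x) _.
rewrite -[n in n%:R]card_ord mulr_natl -sumr_const; apply: ler_sum => i _.
rewrite -[`|x|%R]/(mx_norm x) mx_normrE.
by have /= := @le_bigmax _ _ _ 0 (fun ij : 'I_n * 'I_1 => `|x ij.1 ij.2|) (i, ord0).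
Qed.

Lemma cauchy_schwarz n (x y : 'cV[R]_n) :
  \sum_i x i ord0 * y i ord0 <= enorm x * enorm y.
Proof.
have h : (2^-1 + 2^-1 = 1 :> R) by lra.
have h0 : 0 < 2^-1 :> R by rewrite invr_gt0.
have := @sum_geom_mean_le R _ (index_enum 'I_n) (fun i => x i ord0 ^+ 2)
  (fun i => y i ord0 ^+ 2) _ _ h0 h0 h (fun i => sqr_ge0 _) (fun i => sqr_ge0 _).
rewrite !powR12_sqrt ?sumr_ge0//; try by move=> i _; exact: sqr_ge0.
apply: le_trans; apply: ler_sum => i _.
by rewrite !powR12_sqrt ?sqr_ge0// !sqrtr_sqr -normrM ler_norm.
Qed.

End EuclideanNorm.

(** [opnorm] is a supremum of reals, hence meaningful only once [f] is known to
    be bounded on the unit ball; [B] is a bound available from elsewhere. *)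
Section OperatorNorm.
Context {R : realType} {U V : lmodType R}.
Variables (normU : U -> R) (normV : V -> R).
Hypothesis normU_ge0 : forall u, 0 <= normU u.
Hypothesis normUZ : forall c u, normU (c *: u) = `|c| * normU u.
Hypothesis normVZ : forall c v, normV (c *: v) = `|c| * normV v.
Variable f : U -> V.
Hypothesis fZ : forall c u, f (c *: u) = c *: f u.
Variable B : R.
Hypothesis fB : forall u, normV (f u) <= B * normU u.

Let bounded : has_ubound [set normV (f u) | u in [set u | normU u <= 1]].
Proof.
exists `|B| => _ [u /= u1 <-]; apply: le_trans (fB u) _.
rewrite (le_trans (ler_wpM2r (normU_ge0 u) (ler_norm B)))//.
by rewrite -[leRHS]mulr1 ler_wpM2l.
Qed.

Let unit_ball_le u : normU u <= 1 -> normV (f u) <= opnorm normU normV f.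
Proof. by move=> u1; apply: ub_le_sup => //; exists u. Qed.

Lemma opnorm_ge0 : 0 <= opnorm normU normV f.
Proof.
have := @unit_ball_le 0; rewrite -(scale0r 0) fZ normUZ normVZ normr0 !mul0r.
exact.
Qed.

Lemma ler_opnorm u : normV (f u) <= opnorm normU normV f * normU u.
Proof.
have := normU_ge0 u; rewrite le_eqVlt => /predU1P[u0|u0].
  by have := fB u; rewrite -u0 !mulr0.
rewrite -ler_pdivrMr//.
have -> : normV (f u) / normU u = normV (f ((normU u)^-1 *: u)).
  by rewrite fZ normVZ normfV ger0_norm ?normU_ge0// mulrC.
by apply: unit_ball_le; rewrite normUZ normfV ger0_norm ?normU_ge0// mulVf ?gt_eqF.
Qed.

Lemma opnorm_le : 0 <= B -> opnorm normU normV f <= B.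
Proof.
move=> B0; apply: ge_sup.
  by exists (normV (f 0)), 0 => //=; rewrite -(scale0r 0) normUZ normr0 mul0r.
move=> _ [u /= u1 <-]; rewrite (le_trans (fB u))//.
by rewrite -[leRHS]mulr1 ler_wpM2l.
Qed.

End OperatorNorm.

Section MatrixNorm.
Context {R : realType} {d n : nat}.
Implicit Types (A B : 'M[R]_(d, n)) (u : 'cV[R]_n).

Let mulmx_bounded A u :
  enorm (A *m u) <= (\sum_j enorm (col j A)) * enorm u.
Proof.
have -> : A *m u = \sum_j u j ord0 *: col j A.
  apply/matrixP => i k; rewrite ord1 mxE summxE; apply: eq_bigr => j _.
  by rewrite !mxE mulrC.
apply: le_trans (enorm_sum _ _) _; rewrite mulr_suml; apply: ler_sum => j _.
by rewrite enormZ mulrC ler_wpM2l ?enorm_ge0// ler_coord_enorm.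
Qed.

Let mulmxZ A c u : A *m (c *: u) = c *: (A *m u).
Proof. by rewrite scalemxAr. Qed.

Lemma mnorm_ge0 A : 0 <= mnorm A.
Proof.
exact: (opnorm_ge0 (@enorm_ge0 _ _) (@enormZ _ _) (@enormZ _ _) (mulmxZ A)
  (mulmx_bounded A)).
Qed.

Lemma ler_mnorm A u : enorm (A *m u) <= mnorm A * enorm u.
Proof.
exact: (ler_opnorm (@enorm_ge0 _ _) (@enormZ _ _) (@enormZ _ _) (mulmxZ A)
  (mulmx_bounded A)).
Qed.

Lemma mnorm_le A (K : R) : 0 <= K ->
  (forall u, enorm (A *m u) <= K * enorm u) -> mnorm A <= K.
Proof. by move=> K0 h; exact: (opnorm_le (@enormZ _ _) h). Qed.

Lemma mnormD A B : mnorm (A + B) <= mnorm A + mnorm B.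
Proof.
apply: mnorm_le => [|u]; first by rewrite addr_ge0 ?mnorm_ge0.
by rewrite mulmxDl mulrDl (le_trans (enormD _ _))// lerD ?ler_mnorm.
Qed.

Lemma mnormZ_le c A : mnorm (c *: A) <= `|c| * mnorm A.
Proof.
apply: mnorm_le => [|u]; first by rewrite mulr_ge0 ?mnorm_ge0.
by rewrite -scalemxAl enormZ -mulrA ler_wpM2l// ler_mnorm.
Qed.

Lemma mnormZ c A : mnorm (c *: A) = `|c| * mnorm A.
Proof.
apply/eqP; rewrite eq_le mnormZ_le/=.
have [->|c0] := eqVneq c 0; first by rewrite normr0 mul0r mnorm_ge0.
have := mnormZ_le c^-1 (c *: A); rewrite scalerA mulVf// scale1r normfV.
by rewrite -ler_pdivrMl ?invr_gt0 ?normr_gt0// invrK.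
Qed.

Lemma mnorm0 : mnorm (0 : 'M[R]_(d, n)) = 0.
Proof. by rewrite -(scale0r (0 : 'M[R]_(d, n))) mnormZ normr0 mul0r. Qed.

Lemma mnormN A : mnorm (- A) = mnorm A.
Proof. by rewrite -scaleN1r mnormZ normrN1 mul1r. Qed.

Lemma ler_mnormB A B : mnorm (A - B) <= mnorm A + mnorm B.
Proof. by rewrite -[mnorm B]mnormN mnormD. Qed.

Lemma mnorm_triangle A B C : mnorm (A - C) <= mnorm (A - B) + mnorm (B - C).
Proof. by rewrite -[A - C](subrKA B) mnormD. Qed.

Lemma mnorm_sum (I : Type) (r : seq I) (F : I -> 'M[R]_(d, n)) :
  mnorm (\sum_(i <- r) F i) <= \sum_(i <- r) mnorm (F i).
Proof.
elim: r => [|i r IH]; first by rewrite !big_nil mnorm0.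
by rewrite !big_cons (le_trans (mnormD _ _))// lerD2l.
Qed.

End MatrixNorm.

Section DifferentialNorm.
Context {R : realType} {d n : nat}.
Variable L : 'cV[R]_d -> 'M[R]_(d, n).
Hypothesis L_linear : linear L.

Let LZ c u : L (c *: u) = c *: L u.
Proof.
pose M := GRing.isLinear.Build _ _ _ _ _ L_linear.
pose L' : {linear _ -> _} := HB.pack L M.
by rewrite -[L]/(L' : _ -> _) linearZ.
Qed.

Let L_bounded u : mnorm (L u) <= (\sum_j mnorm (L (delta_mx j ord0))) * enorm u.
Proof.
pose M := GRing.isLinear.Build _ _ _ _ _ L_linear.
pose L' : {linear _ -> _} := HB.pack L M.
have -> : L u = \sum_j u j ord0 *: L (delta_mx j ord0).
  rewrite {1}(matrix_sum_delta u) -[L]/(L' : _ -> _) linear_sum.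
  apply: eq_bigr => j _; rewrite linear_sum big_ord1 linearZ//.
apply: le_trans (mnorm_sum _ _) _; rewrite mulr_suml; apply: ler_sum => j _.
by rewrite mnormZ mulrC ler_wpM2l ?mnorm_ge0// ler_coord_enorm.
Qed.

Lemma ler_dnorm u : mnorm (L u) <= dnorm L * enorm u.
Proof.
exact: (ler_opnorm (@enorm_ge0 _ _) (@enormZ _ _) (@mnormZ _ _ _) LZ L_bounded).
Qed.

End DifferentialNorm.
(** * Second-order differences of differentiable maps *)

(** The mean value theorem fails for vector-valued maps.  It is applied to the
    scalar function [w . g(t) u] with [w = (g 1 - g 0) u], whose increment is
    [|w|^2] and whose derivative is at most [|w| B |u|]. *)
Lemma mnorm_mean_value (R : realType) d n (g dg : R -> 'M[R]_(d, n)) (B : R) :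
  (forall (c : R) i j, is_derive c 1 (fun t => g t i j) (dg c i j)) ->
  (forall c, 0 <= c <= 1 -> mnorm (dg c) <= B) ->
  mnorm (g 1 - g 0) <= B.
Proof.
move=> gd gB.
have B0 : 0 <= B by apply: le_trans (gB 0 _); rewrite ?mnorm_ge0// lexx ler01.
apply: mnorm_le => // u.
set w : 'cV[R]_d := (g 1 - g 0) *m u.
pose F (M : 'M[R]_(d, n)) := \sum_i w i ord0 * \sum_j u j ord0 * M i j.
have FE M : F M = \sum_i w i ord0 * (M *m u) i ord0.
  by apply: eq_bigr => i _; rewrite [(M *m u) _ _]mxE; congr (_ * _);
     apply: eq_bigr => j _; rewrite mulrC.
have Fd (c : R) : is_derive c 1 (F \o g) (F (dg c)).
  have -> : F \o g = \sum_i w i ord0 *: \sum_j u j ord0 *: (fun t => g t i j).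
    apply/funext => t; rewrite fct_sumE /F /=; apply: eq_bigr => i _ /=.
    by rewrite /GRing.scale/= fct_sumE.
  apply: is_derive_sum => i; apply: is_deriveZ; exact: is_derive_sum.
have Fc : {within `[0, 1], continuous (F \o g)}.
  apply: continuous_subspaceT => t; apply: differentiable_continuous.
  by apply/derivable1_diffP; have [] := Fd t.
have [c c01 E] := MVT ltr01 (fun c _ => Fd c) Fc.
have w2 : enorm w ^+ 2 = F (dg c).
  rewrite enorm_sqr; move: E; rewrite subr0 mulr1 /= => <-.
  rewrite !FE -sumrB; apply: eq_bigr => i _; rewrite -mulrBr expr2; congr (_ * _).
  by rewrite /w mulmxBl !mxE.
have c01' : 0 <= c <= 1 by move: c01; rewrite in_itv/= => /andP[/ltW-> /ltW->].
have h : enorm w ^+ 2 <= enorm w * (B * enorm u).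
  rewrite w2 FE (le_trans (cauchy_schwarz _ _))// ler_wpM2l ?enorm_ge0//.
  by rewrite (le_trans (ler_mnorm _ _))// ler_wpM2r ?enorm_ge0// gB.
have := enorm_ge0 w; rewrite le_eqVlt => /predU1P[<-|w0].
  by rewrite mulr_ge0 ?enorm_ge0.
by move: h; rewrite expr2 ler_pM2l.
Qed.

Lemma is_derive_along_line (R : realType) d n (phi : 'cV[R]_d -> 'M[R]_(d, n))
    (x h : 'cV[R]_d) (c : R) i j :
  (forall x, differentiable phi x) ->
  is_derive c 1 (fun t => phi (x + t *: h) i j) ('d phi (x + c *: h) h i j).
Proof.
move=> dphi.
pose lin (t : R) := x + t *: h.
have dlin : is_diff c lin ( *:%R ^~ h).
  have := is_diffD (is_diff_cst x c) (is_diff_scalel c h).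
  by rewrite add0r.
have dl : differentiable lin c by have [] := dlin.
have dp : differentiable (phi \o lin) c by exact: differentiable_comp.
have dc := @differentiable_coord R d n (phi (lin c)) i j.
have dall : differentiable ((fun M : 'M[R]_(d, n) => M i j) \o (phi \o lin)) c.
  exact: differentiable_comp.
apply: DeriveDef; first exact: diff_derivable.
rewrite (deriveE _ dall) diff_comp// diff_comp//=.
have [_ ->] := dlin; rewrite scale1r.
have @f : {linear 'M[R]_(d, n) -> R}.
  by exists (fun N : 'M[R]_(_, _) => N i j); do 2![eexists]; do ?[constructor];
     rewrite ?mxE// => ? *; rewrite ?mxE//; move=> ?; rewrite !mxE.
rewrite -[fun M : 'M[R]_(d, n) => M i j]/(f : _ -> _) diff_lin//.
exact: coord_continuous.
Qed.

Lemma enorm_convex_le (R : realType) d (a b : 'cV[R]_d) (c : R) :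
  0 <= c <= 1 -> enorm ((1 - c) *: a + c *: b) <= enorm a + enorm b.
Proof.
move=> /andP[c0 c1]; apply: le_trans (enormD _ _) _.
rewrite !enormZ !ger0_norm ?subr_ge0//.
by rewrite lerD// ler_piMl ?enorm_ge0// gerBl.
Qed.

(** The difference [phi (x2 + t (y2 - x2)) - phi (x1 + t (y1 - x1))] between
    the values of [phi] along two segments has derivative
    ['d phi p2 (y2 - x2) - 'd phi p1 (y1 - x1)], where [p2 - p1] is a convex
    combination of [x2 - x1] and [y2 - y1].  For [x1 = y1] the bound says that
    [phi] is [K]-Lipschitz. *)
Lemma four_point_bound (R : realType) d n (phi : 'cV[R]_d -> 'M[R]_(d, n))
    (alpha K L : R) (x1 x2 y1 y2 : 'cV[R]_d) :
  0 < alpha -> 0 <= L ->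
  (forall x, differentiable phi x) ->
  (forall x u, mnorm ('d phi x u) <= K * enorm u) ->
  (forall x y u, mnorm ('d phi x u - 'd phi y u)
     <= L * enorm (x - y) `^ alpha * enorm u) ->
  mnorm ((phi y2 - phi x2) - (phi y1 - phi x1))
    <= K * enorm ((y2 - x2) - (y1 - x1))
       + L * (enorm (x2 - x1) + enorm (y2 - y1)) `^ alpha
         * enorm (y1 - x1).
Proof.
move=> a0 L0 dphi hK hL.
pose g t := phi (x2 + t *: (y2 - x2)) - phi (x1 + t *: (y1 - x1)).
have -> : (phi y2 - phi x2) - (phi y1 - phi x1) = g 1 - g 0.
  rewrite /g !scale1r !scale0r !addr0 !subrKC.
  by apply/matrixP => i j; rewrite !mxE; ring.
pose dg t := 'd phi (x2 + t *: (y2 - x2)) (y2 - x2)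
             - 'd phi (x1 + t *: (y1 - x1)) (y1 - x1).
apply: (@mnorm_mean_value _ _ _ g dg) => [c i j|c c01].
  have D2 := is_derive_along_line x2 (y2 - x2) c i j dphi.
  have D1 := is_derive_along_line x1 (y1 - x1) c i j dphi.
  have -> : (fun t => g t i j) = (fun t => phi (x2 + t *: (y2 - x2)) i j)
      - (fun t => phi (x1 + t *: (y1 - x1)) i j).
    by apply/funext => t; rewrite /g !mxE.
  by apply: is_derive_eq; rewrite /dg !mxE.
rewrite /dg; set p2 := x2 + _; set p1 := x1 + _.
have E : 'd phi p2 ((y2 - x2) - (y1 - x1)) =
         'd phi p2 (y2 - x2) - 'd phi p2 (y1 - x1) by exact: linearB.
apply: (le_trans (mnorm_triangle _ ('d phi p2 (y1 - x1)) _)).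
apply: lerD; first by rewrite -E; exact: hK.
apply: le_trans (hL _ _ _) _; rewrite ler_wpM2r ?enorm_ge0// ler_wpM2l//.
apply: ler_powRl; [exact: ltW|exact: enorm_ge0|].
have -> : p2 - p1 = (1 - c) *: (x2 - x1) + c *: (y2 - y1).
  rewrite /p1 /p2; apply/matrixP => i j; rewrite !mxE; ring.
exact: enorm_convex_le.
Qed.
(** * Sums over partitions *)

Section PartitionSums.
Context {R : realType}.
Implicit Types (a b c : R) (s t : seq R).

(** As for [young_sum], the partition is [a :: s], so that [s] may be split and
    concatenated while only the base point moves. *)
Definition psum (V : nmodType) (g : R -> R -> V) a s : V :=
  \sum_(i < size s) g (a :: s)`_i (a :: s)`_i.+1.

Lemma psum_nil (V : nmodType) (g : R -> R -> V) a : psum g a [::] = 0.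
Proof. by rewrite /psum big_ord0. Qed.

Lemma psum_cons (V : nmodType) (g : R -> R -> V) a x s :
  psum g a (x :: s) = g a x + psum g x s.
Proof. by rewrite /psum big_ord_recl. Qed.

Lemma psum_cat (V : nmodType) (g : R -> R -> V) a s t :
  psum g a (s ++ t) = psum g a s + psum g (last a s) t.
Proof.
elim: s a => [a|x s IH a]; first by rewrite psum_nil add0r.
by rewrite cat_cons !psum_cons IH addrA.
Qed.

Lemma psumD (V : nmodType) (g h : R -> R -> V) a s :
  psum (fun u v => g u v + h u v) a s = psum g a s + psum h a s.
Proof. by rewrite /psum big_split. Qed.

Lemma psumB (V : zmodType) (g h : R -> R -> V) a s :
  psum (fun u v => g u v - h u v) a s = psum g a s - psum h a s.
Proof. by rewrite /psum sumrB. Qed.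

Lemma psum_ge0 (g : R -> R -> R) a s :
  (forall u v, 0 <= g u v) -> 0 <= psum g a s.
Proof. by move=> g0; apply: sumr_ge0. Qed.

Lemma psum_increment (V : zmodType) (f : R -> V) a b s : itv_partition a b s ->
  psum (fun u v => f v - f u) a s = f b - f a.
Proof.
elim: s a => [a /itv_partition_nil->|x s IH a ps].
  by rewrite psum_nil subrr.
by rewrite psum_cons (IH _ (itv_partition_cons ps)) addrC subrKA.
Qed.

Lemma itv_partition_head a b x s : itv_partition a b (x :: s) -> a < x.
Proof. by move=> [/= /andP[]]. Qed.

Lemma cons_itv_partition a b x s :
  a < x -> itv_partition x b s -> itv_partition a b (x :: s).
Proof. by move=> ax [xs xb]; split => //=; rewrite ax. Qed.

Lemma ler_psum (g h : R -> R -> R) a b s : itv_partition a b s ->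
  (forall u v, a <= u -> u < v -> v <= b -> g u v <= h u v) ->
  psum g a s <= psum h a s.
Proof.
elim: s a => [a|x s IH a ps gh]; first by rewrite !psum_nil.
have ax := itv_partition_head ps; have xs := itv_partition_cons ps.
rewrite !psum_cons lerD ?gh ?(itv_partition_le xs)//.
by apply: IH => // u v xu; apply: gh; rewrite (le_trans (ltW ax)).
Qed.

Lemma trivial_itv_partition a b : a <= b -> exists s, itv_partition a b s.
Proof.
rewrite le_eqVlt => /predU1P[->|ab]; first by exists [::]; split.
by exists [:: b]; exact: itv_partition1.
Qed.

Lemma itv_partition_mem a b s x : itv_partition a b s -> x \in s -> a < x <= b.
Proof.
elim: s a => // y s IH a ps; have ay := itv_partition_head ps.
have ys := itv_partition_cons ps.
rewrite inE => /predU1P[->|xs]; first by rewrite ay (itv_partition_le ys).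
by have /andP[yx ->] := IH _ ys xs; rewrite (lt_trans ay).
Qed.

(** The point [a] must be left out, as a partition [s] of [[a, b]] does not
    contain it, and so must the points of [l] outside [[a, b]]. *)
Lemma itv_partition_through a b (l : seq R) : a <= b ->
  exists2 s, itv_partition a b s & {subset [seq x <- l | a < x <= b] <= s}.
Proof.
rewrite le_eqVlt => /predU1P[->|ab].
  exists [::]; first by split.
  by move=> x; rewrite mem_filter => /andP[/andP[bx /(lt_le_trans bx)]]; rewrite ltxx.
pose m := sort <=%R (undup [seq x <- l | a < x < b]).
have mab x : (x \in m) -> a < x < b.
  by rewrite mem_sort mem_undup mem_filter => /andP[].
exists (rcons m b).
  split; last by rewrite last_rcons.
  rewrite rcons_path lt_path_sortedE sort_lt_sorted undup_uniq andbT.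
  apply/andP; split; first by apply/allP => x /mab /andP[].
  by have := mem_last a m; rewrite inE => /predU1P[->//|/mab/andP[]].
move=> x; rewrite mem_filter mem_rcons inE => /andP[/andP[ax xb] xl].
have [//|xnb] := eqVneq x b.
by rewrite mem_sort mem_undup mem_filter ax xl lt_neqAle xnb xb.
Qed.

(** For [g u v = |f v - f u|^r] inserting a point may decrease the sum, but
    only by a constant factor.  Hence a bound on the sums over all partitions
    finer than a given one gives a bound over all partitions. *)
Lemma psum_insert_point (g : R -> R -> R) (k : R) a b s x :
  (forall u v, 0 <= g u v) -> 1 <= k ->
  (forall u v w, u < v -> v < w -> g u w <= k * (g u v + g v w)) ->
  itv_partition a b s -> a < x <= b ->
  exists s', [/\ itv_partition a b s', {subset s <= s'}, x \in s' &
    psum g a s <= k * psum g a s'].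
Proof.
move=> g0 k1 gk; have k0 : 0 <= k by rewrite (le_trans ler01).
have up y : 0 <= y -> y <= k * y by move=> y0; rewrite ler_peMl.
elim: s a => [a /itv_partition_nil-> /andP[bx /(lt_le_trans bx)]|y t IH a ps axb].
  by rewrite ltxx.
have yt := itv_partition_cons ps; have ay := itv_partition_head ps.
have s0 := psum_ge0 y t g0.
have [xy|yx|xy] := ltrgtP x y.
- exists [:: x, y & t]; split.
  + by apply: cons_itv_partition; [case/andP: axb|exact: cons_itv_partition].
  + by move=> z zs; rewrite inE zs orbT.
  + by rewrite inE eqxx.
  + rewrite !psum_cons addrA mulrDr lerD ?up//.
    by apply: gk => //; case/andP: axb.
- have [|t' [h1 h2 h3 h4]] := IH y yt; first by rewrite yx; case/andP: axb.
  exists (y :: t'); split.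
  + exact: cons_itv_partition.
  + move=> z; rewrite !inE => /predU1P[->|/h2->]; first by rewrite eqxx.
    by rewrite orbT.
  + by rewrite inE h3 orbT.
  + by rewrite !psum_cons mulrDr lerD// up.
- exists (y :: t); split => //; first by rewrite xy inE eqxx.
  by rewrite up// psum_ge0.
Qed.

Lemma psum_insert (g : R -> R -> R) (k : R) a b s (l : seq R) :
  (forall u v, 0 <= g u v) -> 1 <= k ->
  (forall u v w, u < v -> v < w -> g u w <= k * (g u v + g v w)) ->
  itv_partition a b s -> (forall x, x \in l -> a < x <= b) ->
  exists s', [/\ itv_partition a b s', {subset s <= s'}, {subset l <= s'} &
    psum g a s <= k ^+ size l * psum g a s'].
Proof.
move=> g0 k1 gk; have k0 : 0 <= k by rewrite (le_trans ler01).
elim: l s => [|x l IH] s ps hl.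
  by exists s; split => //; rewrite expr0 mul1r.
have [|s1 [p1 ss1 xs1 le1]] := psum_insert_point g0 k1 gk ps (x := x).
  by apply: hl; rewrite inE eqxx.
have [|s' [p' s1s' ls' le']] := IH s1 p1.
  by move=> z zl; apply: hl; rewrite inE zl orbT.
exists s'; split => //.
- by move=> z /ss1/s1s'.
- by move=> z; rewrite inE => /predU1P[->|/ls'//]; exact: s1s'.
- by rewrite (le_trans le1)// exprS -mulrA ler_wpM2l.
Qed.

End PartitionSums.
(** * Variation norms along partitions *)

Section Variation.
Context {R : realType}.
Implicit Types (a b c : R) (s t : seq R) (g h : R -> R -> R).

(** [pvle p g a b K] says that the [p]-variation on [[a, b]] of the two-parameter
    function [g] is at most [K].  Stating the bound through [K] avoids any
    finiteness side condition, and two-parameter functions make room for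
    majorants of increments such as sums and [vnorm p g] itself. *)
Definition pvle (p : R) g a b (K : R) :=
  forall s, itv_partition a b s -> psum (fun u v => g u v `^ p) a s <= K `^ p.

(** The real supremum is [0] when the sums are unbounded, so the lemmas on
    [vnorm] assume some [pvle p g a b K]. *)
Definition vnorm (p : R) g a b : R :=
  sup [set psum (fun u v => g u v `^ p) a s | s in itv_partition a b] `^ p^-1.

Lemma vnorm_ge0 p g a b : 0 <= vnorm p g a b.
Proof. exact: powR_ge0. Qed.

Let powR_psum_ge0 p g a s : 0 <= psum (fun u v => g u v `^ p) a s.
Proof. by apply: psum_ge0 => *; exact: powR_ge0. Qed.

Let has_sup_psum p g a b K : a <= b -> pvle p g a b K ->
  has_sup [set psum (fun u v => g u v `^ p) a s | s in itv_partition a b].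
Proof.
move=> ab gK; split; last by exists (K `^ p) => _ [s ps <-]; exact: gK.
have [s ps] := trivial_itv_partition ab.
by exists (psum (fun u v => g u v `^ p) a s), s.
Qed.

Let vnorm_powR p g a b K : 0 < p -> a <= b -> pvle p g a b K ->
  vnorm p g a b `^ p =
  sup [set psum (fun u v => g u v `^ p) a s | s in itv_partition a b].
Proof.
move=> p0 ab gK; rewrite powRVK ?gt_eqF//.
have [s ps] := trivial_itv_partition ab.
apply: le_trans (powR_psum_ge0 p g a s) _.
by apply: ub_le_sup; [case: (has_sup_psum ab gK)|exists s].
Qed.

Lemma pvle_vnorm p g a b K : 0 < p -> a <= b -> pvle p g a b K ->
  pvle p g a b (vnorm p g a b).
Proof.
move=> p0 ab gK s ps; rewrite (vnorm_powR p0 ab gK).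
by apply: ub_le_sup; [case: (has_sup_psum ab gK)|exists s].
Qed.

Lemma vnorm_le p g a b K : 0 < p -> a <= b -> 0 <= K -> pvle p g a b K ->
  vnorm p g a b <= K.
Proof.
move=> p0 ab K0 gK; apply: (ler_powR2r p0); rewrite ?vnorm_ge0//.
rewrite (vnorm_powR p0 ab gK); apply: ge_sup.
  by case: (has_sup_psum ab gK).
by move=> _ [s ps <-]; exact: gK.
Qed.

Lemma pvle_le p g h a b K : 0 <= p ->
  (forall u v, a <= u -> u < v -> v <= b -> 0 <= h u v <= g u v) ->
  pvle p g a b K -> pvle p h a b K.
Proof.
move=> p0 hg gK s ps; apply: le_trans (gK s ps).
apply: (ler_psum ps) => u v au uv vb; have /andP[h0 hgu] := hg _ _ au uv vb.
exact: ler_powRl.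
Qed.

Lemma pvle_weaken p g a b K L : 0 <= p -> 0 <= K -> K <= L ->
  pvle p g a b K -> pvle p g a b L.
Proof.
by move=> p0 K0 KL gK s /gK/le_trans; apply; exact: ler_powRl.
Qed.

Lemma pvleD p g h a b K L : 1 <= p -> 0 <= K -> 0 <= L ->
  (forall u v, 0 <= g u v) -> (forall u v, 0 <= h u v) ->
  pvle p g a b K -> pvle p h a b L ->
  pvle p (fun u v => g u v + h u v) a b (K + L).
Proof.
move=> p1 K0 L0 g0 h0 gK hL s ps.
by apply: sum_powR_minkowski => //; [exact: gK|exact: hL].
Qed.

Lemma pvleZ p g a b K c : 0 <= K -> 0 <= c -> (forall u v, 0 <= g u v) ->
  pvle p g a b K -> pvle p (fun u v => c * g u v) a b (c * K).
Proof.
move=> K0 c0 g0 gK s ps; rewrite powRM//.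
have -> : psum (fun u v => (c * g u v) `^ p) a s =
          c `^ p * psum (fun u v => g u v `^ p) a s.
  by rewrite /psum mulr_sumr; apply: eq_bigr => i _; rewrite powRM.
by rewrite ler_wpM2l ?powR_ge0// gK.
Qed.

Lemma pvle_exponent p q g a b K : 0 < p -> p <= q -> 0 <= K ->
  (forall u v, 0 <= g u v) -> pvle p g a b K -> pvle q g a b K.
Proof.
by move=> p0 pq K0 g0 gK s ps; apply: (sum_powR_le_powR p0) => //; exact: gK.
Qed.

Lemma pvle_powR p q g a b K :
  pvle (p * q) g a b K -> pvle q (fun u v => g u v `^ p) a b (K `^ p).
Proof.
move=> gK s /gK; rewrite powRrM; congr (_ <= _).
by apply: eq_bigr => i _; rewrite powRrM.
Qed.

Lemma pvle_sub p g a b K u v : a <= u -> u <= v -> v <= b ->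
  pvle p g a b K -> pvle p g u v K.
Proof.
move=> au uv vb gK s ps.
have [s1 ps1] := trivial_itv_partition au.
have [s2 ps2] := trivial_itv_partition vb.
have p12 := itv_partition_cat ps1 (itv_partition_cat ps ps2).
apply: le_trans (gK _ p12); rewrite psum_cat psum_cat.
have [_ /eqP->] := ps1.
by have := powR_psum_ge0 p g a s1; have := powR_psum_ge0 p g (last u s) s2; lra.
Qed.

Lemma pvle_endpoints p g a b K u v : 0 < p -> 0 <= K -> 0 <= g u v ->
  a <= u -> u < v -> v <= b -> pvle p g a b K -> g u v <= K.
Proof.
move=> p0 K0 g0 au uv vb gK; apply: (ler_powR2r p0) => //.
have := pvle_sub au (ltW uv) vb gK (itv_partition1 uv).
by rewrite psum_cons psum_nil addr0.
Qed.

(** Concatenate a partition of [[a, b]] and one of [[b, c]]. *)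
Lemma vnorm_superadditive p g a b c K : 0 < p -> a <= b -> b <= c ->
  pvle p g a c K ->
  vnorm p g a b `^ p + vnorm p g b c `^ p <= vnorm p g a c `^ p.
Proof.
move=> p0 ab bc gK; have ac := le_trans ab bc.
have gab : pvle p g a b K by exact: pvle_sub gK.
have gbc : pvle p g b c K by exact: pvle_sub gK.
rewrite [X in X + _ <= _](vnorm_powR p0 ab gab).
rewrite [X in _ + X <= _](vnorm_powR p0 bc gbc).
rewrite -lerBrDr; apply: ge_sup; first by case: (has_sup_psum ab gab).
move=> _ [s ps <-]; rewrite lerBrDr addrC -lerBrDr; apply: ge_sup.
  by case: (has_sup_psum bc gbc).
move=> _ [t pt <-]; rewrite lerBrDr addrC.
have := pvle_vnorm p0 ac gK (itv_partition_cat ps pt).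
by rewrite psum_cat; have [_ /eqP->] := ps.
Qed.

(** This is what turns a bound of increments by [vnorm p g u v] into a bound
    for the [p]-variation. *)
Lemma pvle_vnorm_cells p g a b K : 0 < p -> a <= b -> pvle p g a b K ->
  pvle p (vnorm p g) a b (vnorm p g a b).
Proof.
move=> p0 ab gK s ps.
elim: s a ab gK ps => [a|x s IH a] ab gK ps.
  by rewrite psum_nil powR_ge0.
have ax := ltW (itv_partition_head ps); have xs := itv_partition_cons ps.
have xb := itv_partition_le xs.
rewrite psum_cons (le_trans _ (vnorm_superadditive p0 ax xb gK))// lerD2l.
by apply: IH => //; exact: pvle_sub gK.
Qed.

End Variation.

(** * The Young inequality for Riemann sums *)

Section Zeta.
Context {R : realType}.

(** Divided by [x^(1-s)], with [x = k + 2] and [q = (k + 1) / (k + 2)], this is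
    Bernoulli's inequality [(s - 1) (1 - q) <= q^(1-s) - 1]. *)
Lemma riemannR_telescope (s : R) k : 1 < s ->
  (s - 1) * riemannR s k.+1 <= k.+1%:R `^ (1 - s) - k.+2%:R `^ (1 - s).
Proof.
move=> s1; set x : R := k.+2%:R; set y : R := k.+1%:R.
have x0 : 0 < x by rewrite ltr0n.
have y0 : 0 < y by rewrite ltr0n.
have xy : x - y = 1 by rewrite /x /y -natr1 addrC addKr.
have bernoulli (q : R) : 0 < q -> (s - 1) * (1 - q) <= q `^ (1 - s) - 1.
  move=> q0.
  have lnq : ln q <= q - 1.
    have := @le_ln1Dx R (q - 1); rewrite subrKC; apply.
    by rewrite -subr_gt0 opprK subrK.
  have : 1 + (1 - s) * ln q <= q `^ (1 - s).
    by rewrite /powR gt_eqF// expR_ge1Dx.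
  nra.
have xV : x^-1 = 1 - y / x by rewrite -(mulfV (lt0r_neq0 x0)) -mulrBl xy mul1r.
have y_powR : y `^ (1 - s) = x `^ (1 - s) * (y / x) `^ (1 - s).
  by rewrite -powRM ?divr_ge0 ?ltW// mulrC divfK// gt_eqF.
have x_powR : (x `^ s)^-1 = x `^ (1 - s) * x^-1.
  rewrite -powRN -[x^-1]powR_inv1 ?ltW// -powRD ?(gt_eqF x0) ?implybT//.
  by congr (_ `^ _); ring.
rewrite /riemannR -/x y_powR x_powR mulrCA -[X in _ <= _ - X]mulr1 -mulrBr.
by rewrite ler_wpM2l ?powR_ge0// [X in (s - 1) * X]xV bernoulli// divr_gt0.
Qed.

Lemma series_riemannR_le (s : R) n : 1 < s ->
  series (riemannR s) n <= 1 + (s - 1)^-1.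
Proof.
move=> s1; have s10 : 0 < s - 1 by rewrite subr_gt0.
case: n => [|n].
  by rewrite /series/= big_geq// addr_ge0// invr_ge0 ltW.
suff : series (riemannR s) n.+1 <= 1 + (s - 1)^-1 * (1 - n.+1%:R `^ (1 - s)).
  move=> /le_trans; apply; rewrite lerD2l -[leRHS]mulr1.
  by apply: ler_wpM2l; [rewrite invr_ge0 ltW|rewrite gerBl powR_ge0].
elim: n => [|n IH].
  by rewrite /series/= big_nat1 /riemannR !powR1 /= invr1 subrr mulr0 addr0.
have := riemannR_telescope n s1; rewrite -ler_pdivlMl// => h.
rewrite seriesSr.
set r := riemannR s n.+1 in h *; set S := series _ _ in IH *; lra.
Qed.

Lemma cvg_series_riemannR (s : R) : 1 < s -> cvgn (series (riemannR s)).
Proof.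
move=> s1; apply: nondecreasing_is_cvgn.
  apply: nondecreasing_series => n _ _; apply: ltW; apply: riemannR_gt0; lra.
by exists (1 + (s - 1)^-1) => _ [n _ <-]; exact: series_riemannR_le.
Qed.

Lemma series_riemannR_le_zeta (s : R) n : 1 < s ->
  series (riemannR s) n <= zeta s.
Proof.
move=> s1; apply: nondecreasing_cvgn_le; last exact: cvg_series_riemannR.
apply: nondecreasing_series => m _ _; apply: ltW; apply: riemannR_gt0; lra.
Qed.

Lemma zeta_ge1 (s : R) : 1 < s -> 1 <= zeta s.
Proof.
move=> s1; apply: le_trans (series_riemannR_le_zeta 1 s1).
by rewrite /series/= big_nat1 /riemannR !powR1 /= invr1.
Qed.

End Zeta.
(** Extraction of the product [x y] from a weighted geometric mean of powers of
    [x] and [y].  With [lam + mu = 1] the two equations say that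
    [1/p + 1/q = th] and that [lam], [mu] are proportional to [1/p], [1/q]. *)
Lemma le_of_powR_geom_mean (R : realType) (p q lam mu th x y K L c : R) :
  0 <= th -> p * (lam * th) = 1 -> q * (mu * th) = 1 ->
  0 <= x -> 0 <= y -> 0 <= K -> 0 <= L -> 0 <= c ->
  (x `^ p) `^ lam * (y `^ q) `^ mu <= (K `^ p) `^ lam * (L `^ q) `^ mu * c ->
  x * y <= K * L * c `^ th.
Proof.
move=> th0 plam qmu x0 y0 K0 L0 c0.
have eA z : 0 <= z -> ((z `^ p) `^ lam) `^ th = z.
  by move=> z0; rewrite -!powRrM plam powRr1.
have eX z : 0 <= z -> ((z `^ q) `^ mu) `^ th = z.
  by move=> z0; rewrite -!powRrM qmu powRr1.
have mono (t u v w : R) : 0 <= t -> 0 <= u -> 0 <= v -> 0 <= w ->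
    t * u <= v * w * c -> t `^ th * u `^ th <= v `^ th * w `^ th * c `^ th.
  move=> t0 u0 v0 w0 h; rewrite -!powRM ?mulr_ge0//.
  by apply: ler_powRl => //; exact: mulr_ge0.
move=> h; rewrite -(eA x x0) -(eX y y0) -(eA K K0) -(eX L L0).
by apply: mono => //; exact: powR_ge0.
Qed.

Section DiscreteYoung.
Context {R : realType} {d n : nat}.
Variables (A : R -> 'M[R]_(d, n)) (X : R -> 'cV[R]_n).
Variables (alpha r a b KA KX : R).
Hypotheses (alpha0 : 0 < alpha) (r0 : 0 < r) (ralpha : r < 1 + alpha).
Hypotheses (KA0 : 0 <= KA) (KX0 : 0 <= KX).
Hypothesis A_var : pvle (r / alpha) (fun u v => mnorm (A v - A u)) a b KA.
Hypothesis X_var : pvle r (fun u v => enorm (X v - X u)) a b KX.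

Definition young_germ u v : 'cV[R]_d := A u *m (X v - X u).

Let theta1 : 1 < theta alpha r.
Proof. by rewrite /theta ltr_pdivlMr// mul1r. Qed.

(** Removing the point [s`_i] changes the Riemann sum by
    [(A s`_i - A (a :: s)`_i) (X s`_i.+1 - X s`_i)].  The geometric mean with
    weights [alpha / (1 + alpha)] and [1 / (1 + alpha)] of the [r/alpha]-th power
    of the first norm and the [r]-th power of the second is the [1/theta]-th
    power of their product, and some index makes it at most the average. *)
Lemma exists_cheap_point s N : itv_partition a b s -> size s = N.+2 ->
  exists2 i, (i < N.+1)%N &
    mnorm (A s`_i - A (a :: s)`_i) * enorm (X s`_i.+1 - X s`_i)
      <= riemannR (theta alpha r) N * (KA * KX).
Proof.
move=> ps sN; have a1 : 0 < 1 + alpha by rewrite addr_gt0.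
pose wA (i : 'I_N.+1) := mnorm (A s`_i - A (a :: s)`_i) `^ (r / alpha).
pose wX (i : 'I_N.+1) := enorm (X s`_i.+1 - X s`_i) `^ r.
pose lam := alpha / (1 + alpha); pose mu := 1 / (1 + alpha).
have lam0 : 0 < lam by rewrite divr_gt0.
have mu0 : 0 < mu by rewrite divr_gt0.
have lammu : lam + mu = 1 by rewrite /lam /mu -mulrDl addrC mulfV ?gt_eqF.
have wA0 i : 0 <= wA i by exact: powR_ge0.
have wX0 i : 0 <= wX i by exact: powR_ge0.
have sumA : \sum_i wA i <= KA `^ (r / alpha).
  apply: le_trans (A_var ps); rewrite /psum sN [leRHS]big_ord_recr/=.
  by rewrite lerDl powR_ge0.
have sumX : \sum_i wX i <= KX `^ r.
  apply: le_trans (X_var ps); rewrite /psum sN [leRHS]big_ord_recl/=.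
  by rewrite lerDr powR_ge0.
have [i hi] := exists_geom_mean_le lam0 mu0 lammu wA0 wX0.
exists i => //.
have N0 : 0 <= N.+1%:R^-1 :> R by rewrite invr_ge0.
have {hi} : wA i `^ lam * wX i `^ mu <=
    (KA `^ (r / alpha)) `^ lam * (KX `^ r) `^ mu / N.+1%:R.
  apply: le_trans hi _; rewrite ler_wpM2r//.
  by apply: ler_pM; rewrite ?powR_ge0//; apply: ler_powRl => //;
    [exact: ltW|exact: sumr_ge0|exact: ltW|exact: sumr_ge0].
have plam : r / alpha * (lam * theta alpha r) = 1.
  by rewrite /lam /theta; field; rewrite !gt_eqF.
have qmu : r * (mu * theta alpha r) = 1.
  by rewrite /mu /theta; field; rewrite !gt_eqF.
have th0 : 0 <= theta alpha r by rewrite ltW// (lt_trans ltr01).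
move=> /(le_of_powR_geom_mean th0 plam qmu (mnorm_ge0 _) (enorm_ge0 _) KA0 KX0 N0).
move=> /le_trans; apply.
by rewrite /riemannR -powR_inv1 // -powRrM mulN1r powRN mulrC.
Qed.

Lemma psum_young_germ_remove s1 u v w s2 :
  u = last a s1 ->
  psum young_germ a (s1 ++ v :: w :: s2) - psum young_germ a (s1 ++ w :: s2)
    = (A v - A u) *m (X w - X v).
Proof.
move=> ->; rewrite !psum_cat !psum_cons /young_germ; set c := last a s1.
set S := psum _ w s2; set S1 := psum _ a s1.
have -> : X w - X c = (X w - X v) + (X v - X c) by rewrite addrA subrK.
rewrite mulmxBl [A c *m (X w - X v + _)]mulmxDr.
set P := A v *m _; set Q := A c *m (X w - _); set T := A c *m _.
by apply/matrixP => i j; rewrite !mxE; ring.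
Qed.

(** Points are removed until only the endpoints are left; the successive costs
    are the terms of the zeta series. *)
Lemma discrete_young_remainder s N : itv_partition a b s -> size s = N.+1 ->
  enorm (psum young_germ a s - young_germ a b)
    <= series (riemannR (theta alpha r)) N * (KA * KX).
Proof.
elim: N s => [|N IH] s ps sN.
  case: s ps sN => [//|x [|//]] ps _.
  have /itv_partition_nil-> := itv_partition_cons ps.
  rewrite psum_cons psum_nil addr0 subrr enorm0 mulr_ge0 ?mulr_ge0//.
  by rewrite /series/= big_geq.
have [i iN cheap] := exists_cheap_point ps sN.
pose s1 := take i s; pose s2 := drop i.+2 s.
have i2 : (i < size s)%N by rewrite sN ltnS (leq_trans (ltnW iN)).
have i3 : (i.+1 < size s)%N by rewrite sN ltnS.
have se : s = s1 ++ s`_i :: s`_i.+1 :: s2.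
  by rewrite -drop_nth// -drop_nth// cat_take_drop.
have lasts1 : (a :: s)`_i = last a s1.
  rewrite /s1; case: (i) i2 => [|j] jl; first by rewrite take0.
  by rewrite (take_nth 0 (ltnW jl)) last_rcons.
pose s' := s1 ++ s`_i.+1 :: s2.
have ps' : itv_partition a b s'.
  have : itv_partition a b (s1 ++ s`_i :: s`_i.+1 :: s2) by rewrite -se.
  rewrite /itv_partition /s' !cat_path !last_cat /=.
  move=> [/and4P[-> h1 h2 ->] ->]; split => //=.
  by rewrite (lt_trans h1 h2).
have sizes' : size s' = N.+1.
  have := congr1 size se; rewrite sN !size_cat /= !addnS => -[] <-.
  by rewrite ?addnS.
have := IH _ ps' sizes'.
rewrite seriesSr mulrDl => h.
have -> : psum young_germ a s - young_germ a b =
    (psum young_germ a s' - young_germ a b)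
    + (A s`_i - A (a :: s)`_i) *m (X s`_i.+1 - X s`_i).
  rewrite -(psum_young_germ_remove _ _ s2 lasts1) -se -/s'.
  by rewrite [RHS]addrC addrA subrK.
apply: le_trans (enormD _ _) _; apply: lerD => //.
by apply: le_trans (ler_mnorm _ _) _.
Qed.

Lemma discrete_young s : itv_partition a b s ->
  enorm (psum young_germ a s) <= (mnorm (A a) + zeta (theta alpha r) * KA) * KX.
Proof.
move=> ps; have z1 := zeta_ge1 theta1.
have z0 : 0 <= zeta (theta alpha r) by rewrite (le_trans ler01).
have [s0|] := posnP (size s).
  rewrite (size0nil s0) psum_nil enorm0.
  by rewrite mulr_ge0 ?addr_ge0 ?mnorm_ge0 ?mulr_ge0.
case sN : (size s) => [//|N] _.
have ab : a < b by apply: (itv_partition_size_neq0 _ ps); rewrite sN.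
rewrite -[psum _ _ _](subrK (young_germ a b)).
apply: le_trans (enormD _ _) _; rewrite addrC mulrDl; apply: lerD.
  apply: le_trans (ler_mnorm _ _) _; rewrite ler_wpM2l ?mnorm_ge0//.
  by apply: (pvle_endpoints r0 KX0 _ (lexx a) ab (lexx b) X_var); exact: enorm_ge0.
apply: le_trans (discrete_young_remainder ps sN) _.
rewrite -mulrA ler_wpM2r ?mulr_ge0//; exact: series_riemannR_le_zeta.
Qed.

End DiscreteYoung.
(** * Young integrals as limits of Riemann sums *)

Section RiemannLimit.
Context {R : realType}.
Implicit Types (a b c : R) (s t : seq R).

Lemma itv_partition_common_refinement a b s t :
  itv_partition a b s -> itv_partition a b t ->
  exists s', [/\ itv_partition a b s', {subset s <= s'} & {subset t <= s'}].
Proof.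
move=> ps pt; have ab := itv_partition_le ps.
have [s' ps' h] := itv_partition_through (s ++ t) ab.
exists s'; split => // x xs; apply: h; rewrite mem_filter mem_cat xs ?orbT andbT.
  exact: itv_partition_mem xs.
exact: itv_partition_mem xs.
Qed.

Lemma refinement_filter a b : a <= b -> Filter (refinement a b).
Proof.
move=> ab; apply: filter_from_filter.
  exact: trivial_itv_partition.
move=> s t ps pt.
have [s' [ps' ss' ts']] := itv_partition_common_refinement ps pt.
exists s' => // x [px s'x]; split; split => // y ys; apply: s'x.
  exact: ss'.
exact: ts'.
Qed.

Definition riemann_limit d n (A : R -> 'M[R]_(d, n)) (X : R -> 'cV[R]_n) a b
    (v : 'cV[R]_d) :=
  forall eta, 0 < eta -> exists2 s0, itv_partition a b s0 &
    forall s, itv_partition a b s -> {subset s0 <= s} ->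
      enorm (v - psum (young_germ A X) a s) <= eta.

Lemma young_integral_riemann_limit d n (A : R -> 'M[R]_(d, n))
    (X : R -> 'cV[R]_n) a b v : a <= b ->
  is_young_integral A X a b v -> riemann_limit A X a b v.
Proof.
move=> ab lim eta eta0.
have FF := refinement_filter ab.
have e0 : 0 < eta / d.+1%:R by rewrite divr_gt0.
have [s0 ps0 h] := (cvgrPdist_lt _ _).1 lim _ e0.
exists s0 => // s ps s0s; apply: le_trans (enorm_le_mx_norm _) _.
have := h s (conj ps s0s); rewrite ltr_pdivlMr// => /ltW; apply: le_trans.
by rewrite mulrC ler_wpM2l// ler_nat.
Qed.

Variables (d n : nat) (A : R -> 'M[R]_(d, n)) (X : R -> 'cV[R]_n).

(** A fine partition of [[b, c]], extended by a fine partition of [[a, b]], is a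
    fine partition of [[a, c]] through [b]. *)
Lemma riemann_limit_sub a b c v w : a <= b -> b <= c ->
  riemann_limit A X a b v -> riemann_limit A X a c w ->
  riemann_limit A X b c (w - v).
Proof.
move=> ab bc lv lw eta eta0; have eta2 : 0 < eta / 2 by rewrite divr_gt0.
have [s1 ps1 h1] := lv _ eta2; have [s2 ps2 h2] := lw _ eta2.
have [t0 pt0 ht0] := itv_partition_through s2 bc.
exists t0 => // t pt t0t.
have [s ps hs] := itv_partition_through (s1 ++ s2) ab.
have s1s : {subset s1 <= s}.
  by move=> x xs1; apply: hs; rewrite mem_filter mem_cat xs1 (itv_partition_mem ps1).
have s2st : {subset s2 <= s ++ t}.
  move=> x xs2; have /andP[ax xc] := itv_partition_mem ps2 xs2.
  rewrite mem_cat; have [xb|bx] := leP x b.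
    by rewrite hs// mem_filter mem_cat xs2 orbT ax xb.
  by rewrite t0t ?orbT// ht0// mem_filter xs2 bx xc.
have e1 := h1 _ ps s1s; have e2 := h2 _ (itv_partition_cat ps pt) s2st.
move: e2; rewrite psum_cat; have [_ /eqP-> e2] := ps.
set S := psum _ a s in e1 e2; set S' := psum _ b t in e2 *.
have -> : w - v - S' = (w - (S + S')) - (v - S).
  by apply/matrixP => i j; rewrite !mxE; ring.
by apply: le_trans (enormD _ _) _; rewrite enormN; lra.
Qed.

End RiemannLimit.

Lemma riemann_limit_common (R : realType) d n d' n' (A : R -> 'M[R]_(d, n))
    (X : R -> 'cV[R]_n) (A' : R -> 'M[R]_(d', n')) (X' : R -> 'cV[R]_n')
    (a b : R) v v' (eta : R) : 0 < eta ->
  riemann_limit A X a b v -> riemann_limit A' X' a b v' ->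
  exists s, [/\ itv_partition a b s, enorm (v - psum (young_germ A X) a s) <= eta
    & enorm (v' - psum (young_germ A' X') a s) <= eta].
Proof.
move=> eta0 /(_ _ eta0)[s ps hs] /(_ _ eta0)[s' ps' hs'].
have [t [pt st s't]] := itv_partition_common_refinement ps ps'.
by exists t; split; [|exact: hs|exact: hs'].
Qed.

(** * Solutions have finite variation *)

Lemma psum_coord (R : realType) d (g : R -> R -> 'cV[R]_d) a s k :
  psum g a s k ord0 = psum (fun u v => g u v k ord0) a s.
Proof. by rewrite /psum summxE. Qed.

Section SaksHenstock.
Context {R : realType} {d n : nat}.
Variables (A : R -> 'M[R]_(d, n)) (X : R -> 'cV[R]_n) (Y : R -> 'cV[R]_d).
Variables (a b : R).
Hypothesis ab : a <= b.
Hypothesis Y_lim : forall u v, a <= u -> u <= v -> v <= b ->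
  riemann_limit A X u v (Y v - Y u).

Definition young_remainder u v : 'cV[R]_d := (Y v - Y u) - young_germ A X u v.

Let psum_remainder u v s : itv_partition u v s ->
  psum young_remainder u s = (Y v - Y u) - psum (young_germ A X) u s.
Proof. by move=> ps; rewrite psumB (psum_increment _ ps). Qed.

(** The cells that are not kept are replaced by partitions so fine that the
    remainders over each of them nearly cancel; what is left is the sum over the kept cells. *)
Lemma refine_dropped_cells (keep : R -> R -> bool) (eta : R) u s : 0 < eta ->
  a <= u -> itv_partition u b s ->
  exists s', [/\ itv_partition u b s', {subset s <= s'} &
    enorm (psum young_remainder u s'
           - psum (fun x y => if keep x y then young_remainder x y else 0) u s)
      <= (size s)%:R * eta].
Proof.
move=> eta0; elim: s u => [|x s IH] u au ps.
  by exists [::]; split => //; rewrite !psum_nil subrr enorm0 mul0r.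
have ux := itv_partition_head ps; have xs := itv_partition_cons ps.
have [s' [ps' ss' hs']] := IH x (le_trans au (ltW ux)) xs.
have [|] := boolP (keep u x) => kux.
  exists (x :: s'); split; first exact: cons_itv_partition.
    by move=> y; rewrite !inE => /predU1P[->|/ss'->]; rewrite ?eqxx ?orbT.
  rewrite !psum_cons kux opprD addrACA subrr add0r (le_trans hs')//.
  by rewrite ler_wpM2r ?(ltW eta0)// ler_nat.
have [t pt /(_ t pt (fun _ => id)) ht] :=
  Y_lim au (ltW ux) (itv_partition_le xs) eta0.
exists (t ++ s'); split; first exact: itv_partition_cat pt ps'.
  move=> y; rewrite inE mem_cat => /predU1P[->|/ss'->]; last by rewrite orbT.
  have [_ /eqP tx] := pt; have := mem_last u t; rewrite tx inE => /predU1P[xu|->//].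
  by move: ux; rewrite xu ltxx.
rewrite psum_cat psum_cons (negbTE kux) add0r; have [_ /eqP->] := pt.
rewrite -addrA (le_trans (enormD _ _))//= -nat1r mulrDl mul1r lerD//.
by rewrite (psum_remainder pt).
Qed.

(** On refinements [s'] of [s0] the sum of all remainders is at most [1], since
    [Y] itself telescopes.  By [refine_dropped_cells] the sum over any subfamily
    of cells of [s] is then at most [2].  Keeping the cells where a given
    coordinate is nonnegative, and then the others, bounds the sum of absolute
    values of that coordinate by [4]. *)
Lemma bounded_remainder_sums : exists2 s0, itv_partition a b s0 &
  forall s, itv_partition a b s -> {subset s0 <= s} ->
    psum (fun u v => enorm (young_remainder u v)) a s <= 4 * d%:R.
Proof.
have [s0 ps0 hs0] := Y_lim (lexx a) ab (lexx b) ltr01.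
exists s0 => // s ps s0s.
have sub keep :
    enorm (psum (fun x y => if keep x y then young_remainder x y else 0) a s) <= 2.
  (* One share of the tolerance per cell, and one to avoid dividing by 0. *)
  have eta0 : 0 < (size s).+1%:R^-1 :> R by rewrite invr_gt0.
  have [s' [ps' ss' hs']] := refine_dropped_cells keep eta0 (lexx a) ps.
  set S := psum _ a s in hs' *; set S' := psum _ a s' in hs'.
  have hS' : enorm S' <= 1.
    by rewrite /S' (psum_remainder ps') hs0// => x /s0s /ss'.
  have hq : (size s)%:R * (size s).+1%:R^-1 <= 1 :> R.
    by rewrite ler_pdivrMr// mul1r ler_nat.
  have -> : S = S' - (S' - S) by rewrite opprB addrC subrK.
  apply: le_trans (enormD _ _) _; rewrite enormN.
  by have := lerD hS' (le_trans hs' hq); rewrite -natr1.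
have coord k : psum (fun u v => `|young_remainder u v k ord0|) a s <= 4.
  pose pos x y := 0 <= young_remainder x y k ord0.
  pose neg x y := ~~ pos x y.
  have hp := le_trans (ler_coord_enorm _ k) (sub pos).
  have hn := le_trans (ler_coord_enorm _ k) (sub neg).
  move: hp hn; rewrite !psum_coord => hp hn.
  have -> : psum (fun u v => `|young_remainder u v k ord0|) a s =
      psum (fun x y => (if pos x y then young_remainder x y else 0) k ord0) a s
      - psum (fun x y => (if neg x y then young_remainder x y else 0) k ord0) a s.
    have z : (0 : 'cV[R]_d) k ord0 = 0 by rewrite mxE.
    rewrite -psumB; apply: eq_bigr => i _; rewrite /neg /pos.
    case: (leP 0) => h /=; rewrite z ?subr0 ?sub0r.
      by rewrite ger0_norm.
    by rewrite ltr0_norm.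
  apply: le_trans (ler_norm _) _; apply: le_trans (ler_normB _ _) _; lra.
apply: (@le_trans _ _ (\sum_k psum (fun u v => `|young_remainder u v k ord0|) a s)).
  rewrite /psum exchange_big /=; apply: ler_sum => i _; exact: enorm_le_sum.
apply: le_trans (ler_sum _ (fun k _ => coord k)) _.
by rewrite sumr_const card_ord -[4 *+ d]mulr_natr.
Qed.

Lemma powRD_le (r x y : R) : 0 <= r -> 0 <= x -> 0 <= y ->
  (x + y) `^ r <= 2 `^ r * (x `^ r + y `^ r).
Proof.
move=> r0 x0 y0; rewrite mulrDr -!powRM//.
have [xy|yx] := leP x y.
  rewrite -[leLHS]add0r lerD ?powR_ge0//; apply: ler_powRl => //; lra.
rewrite -[leLHS]addr0 lerD ?powR_ge0//; apply: ler_powRl => //; lra.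
Qed.

(** On fine partitions [Y v - Y u] is the sum of a remainder, summable by
    [bounded_remainder_sums] and hence [r]-summable, and of [A u (X v - X u)].  Coarser
    partitions are refined by the points of [s0] at the cost of a constant
    factor. *)
Lemma solution_finite_variation (r M KX : R) : 1 <= r -> 0 <= M -> 0 <= KX ->
  (forall u, a <= u -> u <= b -> mnorm (A u) <= M) ->
  pvle r (fun u v => enorm (X v - X u)) a b KX ->
  exists2 K, 0 <= K & pvle r (fun u v => enorm (Y v - Y u)) a b K.
Proof.
move=> r1 M0 KX0 AM hX; have r0 : 0 < r by rewrite (lt_le_trans ltr01).
have [s0 ps0 hs0] := bounded_remainder_sums.
pose k := 2 `^ r : R.
have k1 : 1 <= k by rewrite -[1](powRr0 2) ler_powR ?ler1n// ltW.
pose D := 4 * d%:R + M * KX : R.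
have D0 : 0 <= D by rewrite addr_ge0 ?mulr_ge0.
exists ((k ^+ size s0) `^ r^-1 * D); first by rewrite mulr_ge0 ?powR_ge0.
move=> s ps; rewrite powRM ?powR_ge0// powRVK ?gt_eqF ?exprn_ge0 ?powR_ge0//.
have [|||s' [ps' ss' s0s' le']] := @psum_insert R
    (fun u v => enorm (Y v - Y u) `^ r) k a b s s0 _ k1 _ ps.
- by move=> u v; exact: powR_ge0.
- move=> u v w _ _; apply: le_trans (powRD_le (ltW r0) (enorm_ge0 _) (enorm_ge0 _)).
  apply: ler_powRl; [exact: ltW|exact: enorm_ge0|].
  have -> : Y w - Y u = (Y v - Y u) + (Y w - Y v) by apply/matrixP => i j; rewrite !mxE; ring.
  exact: enormD.
- by move=> x; exact: itv_partition_mem.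
apply: le_trans le' _; rewrite ler_wpM2l ?exprn_ge0 ?powR_ge0//.
apply: (@le_trans _ _ (psum (fun u v =>
    (enorm (young_remainder u v) + M * enorm (X v - X u)) `^ r) a s')).
  apply: (ler_psum ps') => u v au uv vb.
  apply: ler_powRl; [exact: ltW|exact: enorm_ge0|].
  have -> : Y v - Y u = young_remainder u v + young_germ A X u v.
    by rewrite subrK.
  apply: le_trans (enormD _ _) _; rewrite lerD2l.
  apply: le_trans (ler_mnorm _ _) _; rewrite ler_wpM2r ?enorm_ge0//.
  by rewrite AM// (le_trans (ltW uv)).
apply: sum_powR_minkowski => //; rewrite ?mulr_ge0//.
- by move=> i; exact: enorm_ge0.
- by move=> i; rewrite mulr_ge0 ?enorm_ge0.
- apply: (@sum_powR_le_powR _ _ _ _ 1); rewrite ?mulr_ge0//.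
    by move=> i; exact: enorm_ge0.
  rewrite powRr1 ?mulr_ge0//; under eq_bigr do rewrite powRr1 ?enorm_ge0//.
  exact: hs0.
- exact: (pvleZ KX0 M0 (fun u v => enorm_ge0 (X v - X u)) hX ps').
Qed.

End SaksHenstock.
(** * Variation over intervals, supremum norms and Hoelder seminorms *)

Section VariationOverIntervals.
Context {R : realType} {n : nat}.
Implicit Types (f : R -> 'cV[R]_n) (I : set R) (a b : R).

Definition increment f (u v : R) : R := enorm (f v - f u).

Lemma increment_ge0 f u v : 0 <= increment f u v.
Proof. exact: enorm_ge0. Qed.

Lemma pvle_increment r f I a b K : 0 < r -> 0 <= K ->
  (pvar r f I <= K%:E)%E -> (forall x, a <= x -> x <= b -> I x) ->
  pvle r (increment f) a b K.
Proof.
move=> r0 K0 fK abI s ps.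
have ab := itv_partition_le ps.
have S0 : 0 <= psum (fun u v => increment f u v `^ r) a s.
  by apply: psum_ge0 => *; exact: powR_ge0.
suff h : (psum (fun u v => increment f u v `^ r) a s `^ r^-1) <= K.
  by rewrite -(@powRVK R r (psum _ _ _)) ?gt_eqF// ler_powRl ?powR_ge0// ltW.
rewrite -lee_fin; apply: le_trans fK; apply: ereal_sup_ubound.
exists (a :: s) => //; split; first by case: ps.
move=> x /=; rewrite inE => /predU1P[->|xs]; first exact: abI.
by have /andP[/ltW ax xb] := itv_partition_mem ps xs; exact: abI.
Qed.

Lemma pvar_ge0 r f I : (0 <= pvar r f I)%E.
Proof.
apply: (@le_trans _ _ (0 `^ r^-1)%:E); first by rewrite lee_fin powR_ge0.
by apply: ereal_sup_ubound; exists [::]; [split|rewrite big_ord0].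
Qed.

Lemma pvar_le r f I K : 0 < r -> 0 <= K -> is_interval I ->
  (forall a b, I a -> I b -> a <= b -> pvle r (increment f) a b K) ->
  (pvar r f I <= K%:E)%E.
Proof.
move=> r0 K0 itvI h; apply: ge_ereal_sup => _ [[|a s] [ps sI] <-].
  by rewrite big_ord0 lee_fin powR0 ?invr_eq0 ?gt_eqF.
have ps' : itv_partition a (last a s) s by split.
have Ia : I a by apply: sI; rewrite /= inE eqxx.
have Ib : I (last a s) by apply: sI => /=; exact: mem_last.
have := h _ _ Ia Ib (itv_partition_le ps') _ ps'.
rewrite lee_fin -[K in _ -> _ <= K](@powRK R r) ?gt_eqF// => hs.
apply: ler_powRl => //; first by rewrite invr_ge0 ltW.
by apply: sumr_ge0 => i _; exact: powR_ge0.
Qed.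

Lemma le_pvar r f I J : I `<=` J -> (pvar r f I <= pvar r f J)%E.
Proof.
move=> IJ; apply: ge_ereal_sup => _ [s [ps sI] <-].
by apply: ereal_sup_ubound; exists s => //; split => // x /sI /IJ.
Qed.

End VariationOverIntervals.

Lemma supnorm_ub (R : realType) (U V : Type) (N : V -> R) (psi : U -> V) K x :
  (supnorm N psi <= K%:E)%E -> N (psi x) <= K.
Proof.
move=> h; rewrite -lee_fin; apply: le_trans h.
by apply: ereal_sup_ubound; exists x.
Qed.

Lemma supnorm_le (R : realType) (U V : Type) (N : V -> R) (psi : U -> V) K :
  (forall x, N (psi x) <= K) -> (supnorm N psi <= K%:E)%E.
Proof. by move=> h; apply: ge_ereal_sup => _ [x _ <-]; rewrite lee_fin. Qed.

Lemma holder_ub (R : realType) d (V : zmodType) (N : V -> R) alpha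
    (psi : 'cV[R]_d -> V) K x y : N 0 <= 0 -> alpha != 0 ->
  (holder N alpha psi <= K%:E)%E ->
  N (psi x - psi y) <= K * enorm (x - y) `^ alpha.
Proof.
move=> N0 a0 h; have [->|xy] := eqVneq x y.
  by rewrite !subrr enorm0 powR0// mulr0.
have p0 : 0 < enorm (x - y) `^ alpha.
  rewrite powR_gt0// lt_neqAle enorm_ge0 andbT eq_sym; apply: contraNneq xy.
  by move=> /enorm0_eq0/eqP; rewrite subr_eq0.
rewrite -ler_pdivrMr// -lee_fin; apply: le_trans h.
by apply: ereal_sup_ubound; exists (x, y).
Qed.

Lemma holder_le (R : realType) d (V : zmodType) (N : V -> R) alpha
    (psi : 'cV[R]_d -> V) K : 0 <= K ->
  (forall x y, N (psi x - psi y) <= K * enorm (x - y) `^ alpha) ->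
  (holder N alpha psi <= K%:E)%E.
Proof.
move=> K0 h; apply: ge_ereal_sup => _ [[x y] _ <-] /=; rewrite lee_fin.
have := powR_ge0 (enorm (x - y)) alpha; rewrite le_eqVlt => /predU1P[<-|p0].
  by rewrite invr0 mulr0.
by rewrite ler_pdivrMr.
Qed.

Section DifferentiableBounds.
Context {R : realType} {d n : nat}.
Variable phi : 'cV[R]_d -> 'M[R]_(d, n).

Lemma mnorm_diff_le K x u : (supnorm (@dnorm R d n) (Dfun phi) <= K%:E)%E ->
  mnorm ('d phi x u) <= K * enorm u.
Proof.
move=> h; have L : linear ('d phi x) by move=> c y z; exact: linearP.
apply: le_trans (ler_dnorm L u) _; rewrite ler_wpM2r ?enorm_ge0//.
exact: (supnorm_ub x h).
Qed.

Lemma mnorm_diffB_le alpha K x y u : alpha != 0 ->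
  (holder (@dnorm R d n) alpha (Dfun phi) <= K%:E)%E ->
  mnorm ('d phi x u - 'd phi y u) <= K * enorm (x - y) `^ alpha * enorm u.
Proof.
move=> a0 h.
have L : linear (Dfun phi x - Dfun phi y).
  move=> c z w.
  have Lx : 'd phi x (c *: z + w) = c *: 'd phi x z + 'd phi x w by exact: linearP.
  have Ly : 'd phi y (c *: z + w) = c *: 'd phi y z + 'd phi y w by exact: linearP.
  have E (p q p' q' : 'M[R]_(d, n)) :
      (c *: p + q) - (c *: p' + q') = c *: (p - p') + (q - q').
    by rewrite scalerBr opprD addrACA.
  transitivity ('d phi x (c *: z + w) - 'd phi y (c *: z + w)); first by [].
  exact: (etrans (congr2 (fun p q => p - q) Lx Ly) (E _ _ _ _)).
have -> : 'd phi x u - 'd phi y u = (Dfun phi x - Dfun phi y) u by [].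
apply: (le_trans (ler_dnorm L u)); rewrite ler_wpM2r ?enorm_ge0//.
apply: holder_ub => //.
apply: (opnorm_le (@enormZ _ _)) => // v.
by rewrite mnorm0 mul0r.
Qed.

End DifferentiableBounds.
(** * Estimates for Young integrals and Young equations *)

Section YoungEstimates.
Context {R : realType} {d n : nat}.
Variables (alpha r : R).
Hypotheses (alpha0 : 0 < alpha) (alpha1 : alpha <= 1).
Hypotheses (r1 : 1 <= r) (ralpha : r < 1 + alpha).

Let r0 : 0 < r. Proof. exact: lt_le_trans r1. Qed.

Let zeta0 : 0 <= zeta (theta alpha r).
Proof.
apply: le_trans ler01 (zeta_ge1 _).
by rewrite /theta ltr_pdivlMr// mul1r.
Qed.

Lemma young_integral_bound (A : R -> 'M[R]_(d, n)) X u v w M KA KX :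
  0 <= KA -> 0 <= KX -> riemann_limit A X u v w -> mnorm (A u) <= M ->
  pvle (r / alpha) (fun x y => mnorm (A y - A x)) u v KA ->
  pvle r (increment X) u v KX ->
  enorm w <= (M + zeta (theta alpha r) * KA) * KX.
Proof.
move=> KA0 KX0 lim AM hA hX; apply/ler_addgt0Pl => eta eta0.
have [s ps /(_ s ps (fun _ => id)) hs] := lim _ eta0.
rewrite -(subrK (psum (young_germ A X) u s) w).
apply: le_trans (enormD _ _) _; apply: lerD => //.
apply: le_trans (discrete_young alpha0 r0 ralpha KA0 KX0 hA hX ps) _.
by rewrite ler_wpM2r// lerD2r.
Qed.

Lemma pvle_holder (f g : R -> R -> R) H M a b : 0 <= H -> 0 <= M ->
  (forall u v, 0 <= f u v) ->
  (forall u v, a <= u -> u < v -> v <= b -> 0 <= g u v <= H * f u v `^ alpha) ->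
  pvle r f a b M -> pvle (r / alpha) g a b (H * M `^ alpha).
Proof.
move=> H0 M0 f0 gf hf.
have e : alpha * (r / alpha) = r by rewrite mulrC divfK// gt_eqF.
apply: (@pvle_le _ _ (fun u v => H * f u v `^ alpha)) => //.
  by rewrite divr_ge0 ?ltW.
apply: pvleZ; rewrite ?powR_ge0//; first by move=> u v; exact: powR_ge0.
by apply: pvle_powR; rewrite e.
Qed.

(** If [M = k m] with [k > 1], then [M^alpha <= k m^alpha] gives
    [k m <= (1 + k) P e = (1 + k) m / 2 < k m]. *)
Lemma sublinear_fixpoint_bound (M m P c e : R) :
  0 <= M -> 0 < m -> 0 <= c -> 0 < e -> m = 2 * P * e ->
  c * m `^ alpha <= P -> M <= (P + c * M `^ alpha) * e -> M <= m.
Proof.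
move=> M0 m0 c0 e0 mE cm hM; rewrite leNgt; apply/negP => mM.
have k1 : 1 <= M / m by rewrite ler_pdivlMr// mul1r ltW.
have kM : M `^ alpha <= m `^ alpha * (M / m).
  have -> : M `^ alpha = m `^ alpha * (M / m) `^ alpha.
    by rewrite -powRM ?divr_ge0 ?(ltW m0)// mulrC divfK// gt_eqF.
  by rewrite ler_wpM2l ?powR_ge0// ler1_powR.
have P0 : 0 <= P by rewrite (le_trans _ cm)// mulr_ge0 ?powR_ge0.
have h1 : c * M `^ alpha <= P * (M / m).
  have k0 : 0 <= M / m by exact: le_trans k1.
  apply: le_trans (ler_wpM2l c0 kM) _.
  by rewrite [leLHS]mulrA; apply: (ler_wpM2r k0 cm).
have h2 : M <= (P + P * (M / m)) * e.
  by apply: le_trans hM _; rewrite ler_wpM2r ?lerD2l ?(ltW e0).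
have h3 : (P + P * (M / m)) * e = (m + M) / 2.
  have -> : (P + P * (M / m)) * e = (2 * P * e) * (1 + M / m) / 2 by field; rewrite gt_eqF.
  by rewrite -mE mulrDr mulr1 mulrCA divff ?gt_eqF// mulr1.
lra.
Qed.

(** Young's inequality bounds [V Y] by a sublinear function of itself; this
    only says something because [V Y] is finite. *)
Lemma solution_variation_bound (phi : 'cV[R]_d -> 'M[R]_(d, n)) X Y a b
    (Phi0 Phia eps : R) :
  a <= b -> 0 < Phi0 -> 0 <= Phia -> 0 < eps ->
  (forall x, mnorm (phi x) <= Phi0) ->
  (forall x y, mnorm (phi x - phi y) <= Phia * enorm (x - y) `^ alpha) ->
  zeta (theta alpha r) * Phia * (2 * Phi0 * eps) `^ alpha <= Phi0 ->
  (forall u v, a <= u -> u <= v -> v <= b ->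
    riemann_limit (phi \o Y) X u v (Y v - Y u)) ->
  pvle r (increment X) a b eps ->
  pvle r (increment Y) a b (2 * Phi0 * eps).
Proof.
move=> ab P0 Pa0 e0 hphi hhol small lim hX.
have [K K0 hK] := solution_finite_variation ab lim r1 (ltW P0) (ltW e0)
  (fun u _ _ => hphi (Y u)) hX.
set M := vnorm r (increment Y) a b.
have M0 : 0 <= M by exact: vnorm_ge0.
have hM : pvle r (increment Y) a b M := pvle_vnorm r0 ab hK.
have hA : pvle (r / alpha) (fun u v => mnorm (phi (Y v) - phi (Y u))) a b
    (Phia * M `^ alpha).
  apply: (pvle_holder Pa0 M0 (increment_ge0 Y)) => // u v _ _ _.
  by rewrite mnorm_ge0 hhol.
pose c := zeta (theta alpha r) * Phia.
have c0 : 0 <= c by rewrite mulr_ge0.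
have cM0 : 0 <= Phi0 + c * M `^ alpha by rewrite addr_ge0 ?(ltW P0)// mulr_ge0 ?powR_ge0.
have local u v : a <= u -> u < v -> v <= b ->
    0 <= increment Y u v <= (Phi0 + c * M `^ alpha) * vnorm r (increment X) u v.
  move=> au uv vb; rewrite enorm_ge0 /=.
  have hXuv := pvle_vnorm r0 (ltW uv) (pvle_sub au (ltW uv) vb hX).
  rewrite /c -mulrA.
  exact: (young_integral_bound (mulr_ge0 Pa0 (powR_ge0 _ _)) (vnorm_ge0 _ _ _ _)
    (lim _ _ au (ltW uv) vb) (hphi _) (pvle_sub au (ltW uv) vb hA) hXuv).
have hY : pvle r (increment Y) a b ((Phi0 + c * M `^ alpha) * eps).
  have hV : pvle r (vnorm r (increment X)) a b eps.
    apply: pvle_weaken (pvle_vnorm_cells r0 ab hX); first exact: ltW.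
      exact: vnorm_ge0.
    exact: (vnorm_le r0 ab (ltW e0) hX).
  exact: (pvle_le (ltW r0) local (pvleZ (ltW e0) cM0 (vnorm_ge0 r _) hV)).
apply: pvle_weaken hM; rewrite ?(ltW r0)//.
apply: (@sublinear_fixpoint_bound _ _ Phi0 c eps) => //.
  by rewrite !mulr_gt0.
by apply: vnorm_le hY => //; rewrite mulr_ge0// ltW.
Qed.

(** Here [L] is a Hoelder constant of the differential of [phi], [S] and [H] are
    bounds for the supremum norm and the Hoelder seminorm of [phi - phi'], and
    [m] bounds the variations of [Y] and [Y']. *)
Section Difference.
Variables (phi phi' : 'cV[R]_d -> 'M[R]_(d, n)).
Variables (X X' : R -> 'cV[R]_n) (Y Y' : R -> 'cV[R]_d) (a b : R).
Variables (Phi0 Phia Phi1 L S H eps m : R).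
Hypotheses (ab : a <= b) (Phi0_gt0 : 0 < Phi0) (Phia_ge0 : 0 <= Phia).
Hypotheses (Phi1_ge0 : 0 <= Phi1) (L_ge0 : 0 <= L) (S_ge0 : 0 <= S).
Hypotheses (H_ge0 : 0 <= H) (eps_gt0 : 0 < eps) (m_ge0 : 0 <= m).
Hypothesis phi'_sup : forall x, mnorm (phi' x) <= Phi0.
Hypothesis phi'_holder : forall x y,
  mnorm (phi' x - phi' y) <= Phia * enorm (x - y) `^ alpha.
Hypothesis phi_differentiable : forall x, differentiable phi x.
Hypothesis dphi_sup : forall x u, mnorm ('d phi x u) <= Phi1 * enorm u.
Hypothesis dphi_holder : forall x y u,
  mnorm ('d phi x u - 'd phi y u) <= L * enorm (x - y) `^ alpha * enorm u.
Hypothesis dist_sup : forall x, mnorm (phi x - phi' x) <= S.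
Hypothesis dist_holder : forall x y,
  mnorm ((phi x - phi' x) - (phi y - phi' y)) <= H * enorm (x - y) `^ alpha.
Hypothesis Y_lim : forall u v, a <= u -> u <= v -> v <= b ->
  riemann_limit (phi \o Y) X u v (Y v - Y u).
Hypothesis Y'_lim : forall u v, a <= u -> u <= v -> v <= b ->
  riemann_limit (phi' \o Y') X' u v (Y' v - Y' u).
Hypothesis small : zeta (theta alpha r) * Phia * m `^ alpha <= Phi0.
Hypothesis X_var : pvle r (increment X) a b eps.
Hypothesis Y_var : pvle r (increment Y) a b m.
Hypothesis Y'_var : pvle r (increment Y') a b m.
Variable V : R.
Hypothesis V_ge0 : 0 <= V.
Hypothesis DX_var : pvle r (increment (X \- X')) a b V.

Let DY := Y \- Y'.
Let W := vnorm r (increment DY) a b.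
Let D0 := enorm (DY a).
Let z := zeta (theta alpha r).

Let W_ge0 : 0 <= W. Proof. exact: vnorm_ge0. Qed.
Let D0_ge0 : 0 <= D0. Proof. exact: enorm_ge0. Qed.
Let z_ge0 : 0 <= z. Proof. exact: zeta0. Qed.

(** The coefficient of [V X] in the bound for the increments of [Y - Y']: the
    first line is Young's bound for the integral of [phi(Y) - phi(Y')], the
    second line the one for the integral of [(phi - phi')(Y')]. *)
Definition difference_rate : R :=
  Phi1 * (D0 + W) + z * (Phi1 * W + L * (2 * m) `^ alpha * (D0 + W))
  + (S + z * (H * m `^ alpha)).

Lemma difference_rate_ge0 : 0 <= difference_rate.
Proof. by rewrite !(addr_ge0, mulr_ge0, powR_ge0). Qed.

Lemma DY_var : pvle r (increment DY) a b W.
Proof.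
suff : pvle r (increment DY) a b (m + m) by exact: pvle_vnorm.
apply: (@pvle_le _ _ (fun u v => increment Y u v + increment Y' u v)).
- exact: ltW.
- move=> u v _ _ _; rewrite enorm_ge0 /=.
  rewrite /increment -[enorm (Y' v - Y' u)]enormN.
  have -> : DY v - DY u = (Y v - Y u) + - (Y' v - Y' u).
    by apply/matrixP => i j; rewrite !mxE; ring.
  exact: enormD.
- by apply: pvleD => //; exact: increment_ge0.
Qed.

(** The only place where the initial data enter, through [DY a]. *)
Lemma DY_sup u : a <= u -> u <= b -> enorm (DY u) <= D0 + W.
Proof.
rewrite le_eqVlt => /predU1P[<-|au] ub; first by rewrite lerDl.
have -> : DY u = DY a + (DY u - DY a) by rewrite addrC subrK.
apply: le_trans (enormD _ _) _; rewrite lerD2l.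
exact: (pvle_endpoints r0 W_ge0 (increment_ge0 _ _ _) (lexx a) au ub DY_var).
Qed.

Let E t := phi (Y t) - phi (Y' t).

Lemma E_sup u : a <= u -> u <= b -> mnorm (E u) <= Phi1 * (D0 + W).
Proof.
move=> au ub.
(* The points x1 = y1 = x2 = Y' u and y2 = Y u give the Lipschitz bound. *)
have := four_point_bound (Y' u) (Y' u) (Y' u) (Y u) alpha0 L_ge0
  phi_differentiable dphi_sup dphi_holder.
rewrite !subrr enorm0 mulr0 addr0 !subr0 => /le_trans; apply.
by rewrite ler_wpM2l// DY_sup.
Qed.

Lemma E_var : pvle (r / alpha) (fun u v => mnorm (E v - E u)) a b
  (Phi1 * W + L * (2 * m) `^ alpha * (D0 + W)).
Proof.
pose h u v := (D0 + W) * L * (increment Y' u v + increment Y u v) `^ alpha.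
have h0 u v : 0 <= h u v by rewrite !(mulr_ge0, addr_ge0, powR_ge0).
have DW0 : 0 <= D0 + W by exact: addr_ge0.
have ra0 : 0 < r / alpha by exact: divr_gt0.
have r_le : r <= r / alpha by rewrite ler_pdivlMr// ler_piMr// ltW.
have r_ge1 : 1 <= r / alpha by exact: le_trans r_le.
have hh : pvle (r / alpha) h a b ((D0 + W) * L * (2 * m) `^ alpha).
  apply: (@pvle_holder (fun u v => increment Y' u v + increment Y u v)).
  - exact: mulr_ge0.
  - exact: mulr_ge0.
  - by move=> u v; rewrite addr_ge0 ?increment_ge0.
  - by move=> u v _ _ _; rewrite h0 /=.
  - rewrite mulr2n mulrDl mul1r; apply: pvleD => //; exact: increment_ge0.
have hDY : pvle (r / alpha) (fun u v => Phi1 * increment DY u v) a b (Phi1 * W).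
  apply: pvleZ => //; first exact: increment_ge0.
  by apply: pvle_exponent DY_var => //; exact: increment_ge0.
have -> : L * (2 * m) `^ alpha * (D0 + W) = (D0 + W) * L * (2 * m) `^ alpha by ring.
have sum0 := @pvleD _ _ _ _ _ _ _ _ r_ge1
  (mulr_ge0 Phi1_ge0 W_ge0) (mulr_ge0 (mulr_ge0 DW0 L_ge0) (powR_ge0 _ _))
  (fun u v => mulr_ge0 Phi1_ge0 (increment_ge0 _ u v)) h0 hDY hh.
apply: pvle_le sum0; first exact: ltW.
move=> u v au uv vb; rewrite mnorm_ge0 /=.
have := four_point_bound (Y' u) (Y' v) (Y u) (Y v) alpha0 L_ge0
  phi_differentiable dphi_sup dphi_holder.
have -> : Y v - Y' v - (Y u - Y' u) = DY v - DY u by [].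
move=> /le_trans; apply; rewrite lerD2l /h.
rewrite [leLHS]mulrC -[leRHS]mulrA; apply: ler_wpM2r.
  by rewrite mulr_ge0 ?powR_ge0.
by apply: DY_sup => //; rewrite (le_trans (ltW uv)).
Qed.

Lemma difference_increment_bound u v : a <= u -> u <= v -> v <= b ->
  increment DY u v <= difference_rate * vnorm r (increment X) u v
    + 2 * Phi0 * vnorm r (increment (X \- X')) u v.
Proof.
move=> au uv vb; have ub := le_trans uv vb.
apply/ler_addgt0Pl => eta eta0; have eta2 : 0 < eta / 2 by rewrite divr_gt0.
(* The same partition must serve for both solutions, so that the Riemann sums
   can be regrouped. *)
have [s [ps hs hs']] := riemann_limit_common eta2 (Y_lim au uv vb) (Y'_lim au uv vb).
pose D t := phi (Y' t) - phi' (Y' t).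
pose vX := vnorm r (increment X) u v.
pose vDX := vnorm r (increment (X \- X')) u v.
have vX0 : 0 <= vX by exact: vnorm_ge0.
have vDX0 : 0 <= vDX by exact: vnorm_ge0.
have hX : pvle r (increment X) u v vX := pvle_vnorm r0 uv (pvle_sub au uv vb X_var).
have hDX : pvle r (increment (X \- X')) u v vDX :=
  pvle_vnorm r0 uv (pvle_sub au uv vb DX_var).
have hE : enorm (psum (young_germ E X) u s) <= (Phi1 * (D0 + W) +
    z * (Phi1 * W + L * (2 * m) `^ alpha * (D0 + W))) * vX.
  have K0 : 0 <= Phi1 * W + L * (2 * m) `^ alpha * (D0 + W).
    by rewrite !(addr_ge0, mulr_ge0, powR_ge0).
  apply: le_trans (discrete_young alpha0 r0 ralpha K0 vX0
    (pvle_sub au uv vb E_var) hX ps) _.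
  exact: (ler_wpM2r vX0 (lerD (E_sup au ub) (lexx _))).
have hD : enorm (psum (young_germ D X) u s) <= (S + z * (H * m `^ alpha)) * vX.
  have K0 : 0 <= H * m `^ alpha by rewrite mulr_ge0 ?powR_ge0.
  have D_var : pvle (r / alpha) (fun x y => mnorm (D y - D x)) a b (H * m `^ alpha).
    apply: (pvle_holder H_ge0 m_ge0 (increment_ge0 Y')) => // x y _ _ _.
    by rewrite mnorm_ge0 dist_holder.
  apply: le_trans (discrete_young alpha0 r0 ralpha K0 vX0
    (pvle_sub au uv vb D_var) hX ps) _.
  exact: (ler_wpM2r vX0 (lerD (dist_sup _) (lexx _))).
have hA' : enorm (psum (young_germ (phi' \o Y') (X \- X')) u s) <= 2 * Phi0 * vDX.
  have K0 : 0 <= Phia * m `^ alpha by rewrite mulr_ge0 ?powR_ge0.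
  have A'_var : pvle (r / alpha)
      (fun x y => mnorm ((phi' \o Y') y - (phi' \o Y') x)) a b (Phia * m `^ alpha).
    apply: (pvle_holder Phia_ge0 m_ge0 (increment_ge0 Y')) => // x y _ _ _.
    by rewrite mnorm_ge0 phi'_holder.
  apply: le_trans (discrete_young alpha0 r0 ralpha K0 vDX0
    (pvle_sub au uv vb A'_var) hDX ps) _.
  rewrite ler_wpM2r// [2 * Phi0]mulr_natl mulr2n mulrA lerD//.
  exact: phi'_sup.
have split : psum (young_germ (phi \o Y) X) u s - psum (young_germ (phi' \o Y') X') u s =
    (psum (young_germ E X) u s + psum (young_germ D X) u s)
    + psum (young_germ (phi' \o Y') (X \- X')) u s.
  rewrite -psumB -!psumD; apply: eq_bigr => i _; rewrite /young_germ /E /D /=.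
  rewrite -mulmxDl subrKA.
  set x := s`_i; set y := (u :: s)`_i.
  have -> : X x - X' x - (X y - X' y) = (X x - X y) - (X' x - X' y).
    by apply/matrixP => k l; rewrite !mxE; ring.
  move: (X x - X y) (X' x - X' y) => dX dX'.
  by rewrite mulmxBl mulmxBr addrA subrK.
rewrite /increment.
have -> : DY v - DY u =
    ((Y v - Y u) - psum (young_germ (phi \o Y) X) u s)
    - ((Y' v - Y' u) - psum (young_germ (phi' \o Y') X') u s)
    + (psum (young_germ (phi \o Y) X) u s - psum (young_germ (phi' \o Y') X') u s).
  set P := psum _ _ _; set Q := psum _ _ _.
  by apply/matrixP => i j; rewrite !mxE; ring.
rewrite split {split}.
apply: le_trans (enormD _ _) _; apply: lerD.
  by apply: le_trans (enormD _ _) _; rewrite enormN; lra.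
apply: le_trans (enormD _ _) _; apply: lerD; last exact: hA'.
apply: le_trans (enormD _ _) _; rewrite /difference_rate mulrDl.
exact: lerD hE hD.
Qed.

Lemma difference_variation_bound u v KX KDX :
  a <= u -> u <= v -> v <= b -> 0 <= KX -> 0 <= KDX ->
  pvle r (increment X) u v KX -> pvle r (increment (X \- X')) u v KDX ->
  pvle r (increment DY) u v (difference_rate * KX + 2 * Phi0 * KDX).
Proof.
move=> au uv vb KX0 KDX0 hX hDX; have g0 := difference_rate_ge0.
have P0 : 0 <= 2 * Phi0 by rewrite mulr_ge0// ltW.
pose g x y := difference_rate * vnorm r (increment X) x y
    + 2 * Phi0 * vnorm r (increment (X \- X')) x y.
apply: (@pvle_le _ _ g); first exact: ltW.
  move=> x y ux xy yv; rewrite enorm_ge0 difference_increment_bound//.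
  - exact: le_trans ux.
  - exact: ltW.
  - exact: le_trans vb.
have cells f K : 0 <= K -> pvle r (increment f) u v K ->
    pvle r (vnorm r (@increment R n f)) u v K.
  move=> K0 hf; apply: pvle_weaken (pvle_vnorm_cells r0 uv hf); first exact: ltW.
    exact: vnorm_ge0.
  exact: vnorm_le hf.
exact: (pvleD r1 (mulr_ge0 g0 KX0) (mulr_ge0 P0 KDX0)
  (fun x y => mulr_ge0 g0 (vnorm_ge0 _ _ x y))
  (fun x y => mulr_ge0 P0 (vnorm_ge0 _ _ x y))
  (pvleZ KX0 g0 (vnorm_ge0 _ _) (cells _ _ KX0 hX))
  (pvleZ KDX0 P0 (vnorm_ge0 _ _) (cells _ _ KDX0 hDX))).
Qed.

(** The rate is [G W + P], with [G] as in the hypothesis, and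
    [W <= rate eps + 2 Phi0 V], so that [rate <= 3/4 rate + 2 Phi0 V G + P]. *)
Lemma difference_rate_bound :
  (Phi1 * (1 + z) + z * L * (2 * m) `^ alpha) * eps <= 3 / 4 ->
  difference_rate <=
    8 * Phi0 * V * (Phi1 * (1 + z) + z * L * (2 * m) `^ alpha)
    + 4 * (D0 * (Phi1 + z * L * (2 * m) `^ alpha) + S + z * (H * m `^ alpha)).
Proof.
set q := (2 * m) `^ alpha; set G := _ + _ => Geps.
have q0 : 0 <= q by exact: powR_ge0.
have G0 : 0 <= G by rewrite !(addr_ge0, mulr_ge0).
have hW : W <= difference_rate * eps + 2 * Phi0 * V.
  apply: vnorm_le r0 ab _ _; last first.
    exact: difference_variation_bound (lexx a) ab (lexx b) (ltW eps_gt0) V_ge0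
      X_var DX_var.
  exact: addr_ge0 (mulr_ge0 difference_rate_ge0 (ltW eps_gt0))
    (mulr_ge0 (mulr_ge0 (ler0n _ 2) (ltW Phi0_gt0)) V_ge0).
have rE : difference_rate =
    G * W + (D0 * (Phi1 + z * L * q) + S + z * (H * m `^ alpha)).
  by rewrite /difference_rate -/q /G; ring.
have h1 : G * W <= difference_rate * (3 / 4) + G * (2 * Phi0 * V).
  apply: le_trans (ler_wpM2l G0 hW) _; rewrite mulrDr lerD2r mulrCA.
  by rewrite ler_wpM2l ?difference_rate_ge0.
move: rE h1; set g := difference_rate; set P := D0 * _ + _ + _.
have -> : 8 * Phi0 * V * G = 4 * (G * (2 * Phi0 * V)) by ring.
lra.
Qed.

End Difference.
End YoungEstimates.
(** * Stability of Young equations *)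

(** The smallness conditions carry the factor [c = 2^(theta - 1) >= 1], which
    Young's inequality in the form used here does not produce; it is absorbed
    by [z <= c z]. *)
Section SmallnessConstants.
Context {R : realType}.
Variables (alpha r Phi0 Phia Phi1 L eps : R).
Hypotheses (alpha0 : 0 < alpha) (alpha1 : alpha <= 1) (r0 : 0 < r).
Hypothesis ralpha : r < 1 + alpha.
Hypotheses (Phi0_gt0 : 0 < Phi0) (Phia_gt0 : 0 < Phia).
Hypotheses (Phi1_gt0 : 0 < Phi1) (L_gt0 : 0 < L) (eps_gt0 : 0 < eps).
Hypothesis small_sup : 2 `^ (alpha + theta alpha r - 1) * zeta (theta alpha r) * Phia
    * eps `^ alpha <= Phi0 `^ (1 - alpha).
Hypothesis small_lip :
  2 `^ (theta alpha r - 1) * zeta (theta alpha r) * Phi1 * eps <= 8^-1.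
Hypothesis small_holder :
  2 `^ (theta alpha r - 1) * zeta (theta alpha r) * 2 `^ alpha * Phi0 `^ alpha
    * (L / (1 + alpha)) * eps `^ (1 + alpha) <= 8^-1.

Let z := zeta (theta alpha r).
Let c : R := 2 `^ (theta alpha r - 1).
Let t : R := 2 `^ alpha.
Let p := Phi0 `^ alpha.
Let e := eps `^ alpha.
Let f := Phi0 `^ (1 - alpha).

Let theta1 : 1 < theta alpha r.
Proof. by rewrite /theta ltr_pdivlMr// mul1r. Qed.

Let z1 : 1 <= z. Proof. exact: zeta_ge1. Qed.

Let c1 : 1 <= c.
Proof. by rewrite -[1](powRr0 2) ler_powR ?ler1n// subr_ge0 ltW. Qed.

Let t1 : 1 <= t.
Proof. by rewrite -[1](powRr0 2) ler_powR ?ler1n// ltW. Qed.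

Let t2 : t <= 2.
Proof. by rewrite -[leRHS]powRr1// ler_powR ?ler1n. Qed.

Let p0 : 0 < p. Proof. exact: powR_gt0. Qed.
Let e0 : 0 < e. Proof. exact: powR_gt0. Qed.
Let f0 : 0 < f. Proof. exact: powR_gt0. Qed.

Let pf : p * f = Phi0.
Proof.
rewrite /p /f -powRD ?(gt_eqF Phi0_gt0) ?implybT//.
by rewrite subrKC powRr1// ltW.
Qed.

Let powR_m : (2 * Phi0 * eps) `^ alpha = t * p * e.
Proof. by rewrite !powRM ?mulr_ge0// ltW. Qed.

Let powR_2m : (2 * (2 * Phi0 * eps)) `^ alpha = t * (t * p * e).
Proof.
rewrite -powR_m; apply: powRM => //.
by apply: mulr_ge0; [apply: mulr_ge0 => //|]; exact: ltW.
Qed.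

Let small_sup' : z * Phia * t * e <= f.
Proof.
have tE : 2 `^ (alpha + theta alpha r - 1) = t * c.
  by rewrite -addrA powRD// pnatr_eq0 implybT.
move: small_sup; rewrite tE => h; apply: le_trans h.
have h0 : 0 <= z * Phia * t * e.
  by rewrite !mulr_ge0// ?(ltW e0) ?(ltW Phia_gt0)// ?(le_trans ler01).
have -> : t * c * zeta (theta alpha r) * Phia * eps `^ alpha =
          c * (z * Phia * t * e) by rewrite /z /e; ring.
exact: ler_peMl.
Qed.

Lemma smallness_variation :
  zeta (theta alpha r) * Phia * (2 * Phi0 * eps) `^ alpha <= Phi0.
Proof.
rewrite powR_m -[leRHS]pf.
have -> : zeta (theta alpha r) * Phia * (t * p * e) = p * (z * Phia * t * e).
  by rewrite /z; ring.
by rewrite ler_wpM2l ?(ltW p0).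
Qed.

Lemma smallness_contraction :
  (Phi1 * (1 + z) + z * L * (2 * (2 * Phi0 * eps)) `^ alpha) * eps <= 3 / 4.
Proof.
have epsE : eps `^ (1 + alpha) = eps * e.
  by rewrite powRD ?(gt_eqF eps_gt0) ?implybT// powRr1 ?ltW.
rewrite powR_2m.
have z0 : 0 <= z by exact: le_trans z1.
have u0 : 0 <= Phi1 * eps by rewrite mulr_ge0 ?ltW.
have h1 : z * (Phi1 * eps) <= 8^-1.
  apply: le_trans small_lip; rewrite -!mulrA ler_peMl// mulr_ge0//.
have h2 : Phi1 * eps <= 8^-1 by apply: le_trans h1; exact: ler_peMl.
pose a1 := 1 + alpha.
have a10 : 0 < a1 by rewrite addr_gt0.
pose w := z * t * p * (L / a1) * (eps * e).
have w0 : 0 <= w.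
  by rewrite !mulr_ge0 ?invr_ge0 ?(ltW p0) ?(ltW e0) ?(ltW a10) ?(ltW L_gt0)
    ?(ltW eps_gt0)// (le_trans ler01).
have h3 : w <= 8^-1.
  apply: le_trans small_holder; rewrite epsE.
  have -> : 2 `^ (theta alpha r - 1) * zeta (theta alpha r) * 2 `^ alpha
    * Phi0 `^ alpha * (L / (1 + alpha)) * (eps * e) = c * w.
    by rewrite /w /c /z /t /p /a1; ring.
  exact: ler_peMl.
have h4 : z * L * (t * (t * p * e)) * eps <= 4 * w.
  have -> : z * L * (t * (t * p * e)) * eps = (t * a1) * w.
    by rewrite /w; field; rewrite gt_eqF.
  rewrite ler_wpM2r// -[4]/(2 * 2)%:R natrM ler_pM ?(ltW a10)//.
    exact: le_trans t1.
  by rewrite /a1 -[2]/(1 + 1) lerD2l.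
lra.
Qed.

(** The Hoelder term is the only one that needs the constant to depend on [Phi0]
    and [Phia]: the first smallness condition bounds [z m^alpha], for
    [m = 2 Phi0 eps], by [Phi0^alpha / Phia] times [Phi0^(1 - alpha)].  In the
    other terms the powers of [2] are compared through [2^alpha <= 2]. *)
Lemma smallness_rate (V D0 S H g : R) :
  0 <= V -> 0 <= D0 -> 0 <= S -> 0 <= H ->
  g <= 8 * Phi0 * V * (Phi1 * (1 + z) + z * L * (2 * (2 * Phi0 * eps)) `^ alpha)
    + 4 * (D0 * (Phi1 + z * L * (2 * (2 * Phi0 * eps)) `^ alpha) + S
           + z * (H * (2 * Phi0 * eps) `^ alpha)) ->
  g <= (8 + 4 * (Phi0 `^ alpha / Phia)) *
    (((Csew alpha r + 1) * Phi1 + Csew alpha r * 2 `^ (alpha + 1) * L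
        * Phi0 `^ alpha * eps `^ alpha) * Phi0 * V
     + (Csew alpha r * 2 `^ (alpha + 1) * L * Phi0 `^ alpha * eps `^ alpha + Phi1)
        * D0
     + Phi0 `^ (1 - alpha) * H + S).
Proof.
move=> V0 D00 S0 H0; rewrite powR_m powR_2m => hg; apply: le_trans hg _.
have -> : 2 `^ (alpha + 1) = t * 2 :> R.
  by rewrite powRD ?powRr1// pnatr_eq0 implybT.
have -> : Csew alpha r = c * z by [].
rewrite -/p -/e -/f.
have z0 : 0 <= z by exact: le_trans z1.
have t0 : 0 <= t by exact: le_trans t1.
have v0 : 0 <= z * t * L * p * e.
  by rewrite !mulr_ge0 ?(ltW p0) ?(ltW e0) ?(ltW L_gt0).
pose q := z * L * (t * (t * p * e)).
pose q' := c * z * (t * 2) * L * p * e.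
have qq' : q <= q'.
  have -> : q = t * (z * t * L * p * e) by rewrite /q; ring.
  have -> : q' = 2 * (c * (z * t * L * p * e)) by rewrite /q'; ring.
  by apply: ler_pM => //; exact: ler_peMl.
have q0 : 0 <= q by rewrite !mulr_ge0 ?(ltW p0) ?(ltW e0) ?(ltW L_gt0).
have zcz : z <= c * z by exact: ler_peMl.
have Phi1_ge0 := ltW Phi1_gt0.
have hG : Phi1 * (1 + z) + q <= (c * z + 1) * Phi1 + q'.
  apply: lerD => //; rewrite mulrC ler_wpM2r// addrC; exact: lerD.
have PV0 : 0 <= Phi0 * V by rewrite mulr_ge0 ?(ltW Phi0_gt0).
have b1 : 8 * Phi0 * V * (Phi1 * (1 + z) + q) <=
    8 * (((c * z + 1) * Phi1 + q') * Phi0 * V).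
  have -> : 8 * Phi0 * V * (Phi1 * (1 + z) + q) =
    8 * (Phi0 * V * (Phi1 * (1 + z) + q)) by ring.
  have -> : ((c * z + 1) * Phi1 + q') * Phi0 * V =
    Phi0 * V * ((c * z + 1) * Phi1 + q') by ring.
  by rewrite ler_wpM2l// ler_wpM2l.
have b2 : D0 * (Phi1 + q) <= (q' + Phi1) * D0.
  by rewrite mulrC ler_wpM2r// addrC lerD2r.
have b3 : z * (H * (t * p * e)) <= p / Phia * (f * H).
  have -> : z * (H * (t * p * e)) = p / Phia * (z * Phia * t * e * H).
    by field; rewrite gt_eqF.
  rewrite ler_wpM2l ?divr_ge0 ?(ltW p0) ?(ltW Phia_gt0)//.
  by rewrite ler_wpM2r.
set k := p / Phia in b3 *.
have k0 : 0 <= k by rewrite divr_ge0 ?(ltW p0) ?(ltW Phia_gt0).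
set B1 := ((c * z + 1) * Phi1 + q') * Phi0 * V in b1 *.
set B2 := (q' + Phi1) * D0 in b2 *.
have q'0 : 0 <= q' by exact: le_trans qq'.
have B10 : 0 <= B1.
  exact: mulr_ge0 (mulr_ge0 (addr_ge0 (mulr_ge0 (addr_ge0 (le_trans z0 zcz) ler01)
    Phi1_ge0) q'0) (ltW Phi0_gt0)) V0.
have B20 : 0 <= B2 by rewrite /B2 mulr_ge0// addr_ge0.
have fH0 : 0 <= f * H by rewrite mulr_ge0 ?(ltW f0).
have k1 : 0 <= k * B1 by rewrite mulr_ge0.
have k2 : 0 <= k * B2 by rewrite mulr_ge0.
have k3 : 0 <= k * S by rewrite mulr_ge0.
rewrite -/q -/q' mulrDl -mulrA !mulrDr.
lra.
Qed.

End SmallnessConstants.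

Lemma young_solution_riemann_limit (R : realType) d n
    (phi : 'cV[R]_d -> 'M[R]_(d, n)) X y0 T Y : 0 <= T ->
  young_solution phi X y0 T Y -> Y 0 = y0 /\
  forall u v, 0 <= u -> u <= v -> v <= T ->
    riemann_limit (phi \o Y) X u v (Y v - Y u).
Proof.
move=> T0 sol.
have lim t : 0 <= t -> t <= T -> riemann_limit (phi \o Y) X 0 t (Y t - y0).
  move=> t0 tT; apply: young_integral_riemann_limit => //.
  by apply: sol; rewrite t0.
split.
  apply/eqP; rewrite -subr_eq0; apply/eqP; apply: enorm0_eq0; apply/eqP.
  rewrite eq_le enorm_ge0 andbT; apply/ler_addgt0Pl => eta eta0; rewrite addr0.
  have [s ps /(_ s ps (fun _ => id))] := lim 0 (lexx 0) T0 _ eta0.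
  by rewrite (itv_partitionxx ps) psum_nil subr0.
move=> u v u0 uv vT.
have -> : Y v - Y u = (Y v - y0) - (Y u - y0) by rewrite opprB addrA subrK.
apply: (@riemann_limit_sub _ _ _ _ _ 0) => //; apply: lim => //.
- exact: le_trans vT.
- exact: le_trans uv.
Qed.

(* The implicit constant C depends only on alpha, Phi0 and Phia.  It cannot be
   independent of Phia: the term Phi0 ^ (1 - alpha) * ||Delta phi||_{C^alpha}
   does not scale like gamma under rescaling of X and Y. *)
Theorem theorem1p3 (R : realType) (alpha Phi0 Phia : R) :
  exists C : R, 0 < C /\
  forall (r Phi1 Phi1a epsilon T : R) (n d : nat)
    (phi phi' : 'cV[R]_d -> 'M[R]_(d, n))
    (X X' : R -> 'cV[R]_n) (Y Y' : R -> 'cV[R]_d) (y0 y0' : 'cV[R]_d),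
  1 <= r -> r < 1 + alpha -> 1 + alpha <= 2 ->
  0 < Phi0 -> 0 < Phia -> 0 < Phi1 -> 0 < Phi1a ->
  0 < epsilon ->
  2 `^ (alpha + theta alpha r - 1) * zeta (theta alpha r) * Phia
    * epsilon `^ alpha <= Phi0 `^ (1 - alpha) ->
  2 `^ (theta alpha r - 1) * zeta (theta alpha r) * Phi1 * epsilon <= 8^-1 ->
  2 `^ (theta alpha r - 1) * zeta (theta alpha r) * 2 `^ alpha * Phi0 `^ alpha
    * (Phi1a / (1 + alpha)) * epsilon `^ (1 + alpha) <= 8^-1 ->
  C1alpha_b alpha phi -> C1alpha_b alpha phi' ->
  C1alpha_bounds alpha Phi0 Phia Phi1 Phi1a phi ->
  C1alpha_bounds alpha Phi0 Phia Phi1 Phi1a phi' ->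
  0 < T ->
  (pvar r X `[0%R, T] < +oo)%E -> (pvar r X' `[0%R, T] < +oo)%E ->
  young_solution phi X y0 T Y -> young_solution phi' X' y0' T Y' ->
  (pvar r X `[0%R, T] < epsilon%:E)%E -> (pvar r X' `[0%R, T] < epsilon%:E)%E ->
  exists gamma : R,
    (gamma%:E <= C%:E *
       ((((Csew alpha r + 1) * Phi1
          + Csew alpha r * 2 `^ (alpha + 1) * Phi1a * Phi0 `^ alpha
            * epsilon `^ alpha) * Phi0)%:E * pvar r (X \- X')%R `[0%R, T]
        + ((Csew alpha r * 2 `^ (alpha + 1) * Phi1a * Phi0 `^ alpha
            * epsilon `^ alpha + Phi1) * enorm (y0 - y0'))%:E
        + (Phi0 `^ (1 - alpha))%:E * holder (@mnorm R d n) alpha (phi \- phi')%R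
        + supnorm (@mnorm R d n) (phi \- phi')%R))%E /\
    forall I : set R, is_interval I -> I `<=` `[0%R, T] ->
      (pvar r (Y \- Y')%R I
       <= gamma%:E * pvar r X I + (2 * Phi0)%:E * pvar r (X \- X')%R I)%E.
Proof.
exists (8 + 4 * (Phi0 `^ alpha / `|Phia|)); split.
  by rewrite ltr_wpDr// mulr_ge0// divr_ge0 ?powR_ge0.
move=> r Phi1 L eps T n d phi phi' X X' Y Y' y0 y0' r1 ralpha alpha1'.
move=> Phi0_gt0 Phia_gt0 Phi1_gt0 L_gt0 eps_gt0 small_sup small_lip small_holder.
move=> [dphi _ _ _] _ [phi_sup phi_holder dphi_sup dphi_holder].
move=> [phi'_sup phi'_holder _ _] T_gt0 _ _ solY solY' X_eps X'_eps.
have r0 : 0 < r by exact: lt_le_trans r1.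
have alpha0 : 0 < alpha by lra.
have alpha1 : alpha <= 1 by lra.
have alpha_neq0 : alpha != 0 by exact: lt0r_neq0.
have T0 := ltW T_gt0.
have [Y0 Ylim] := young_solution_riemann_limit T0 solY.
have [Y'0 Y'lim] := young_solution_riemann_limit T0 solY'.
have inI x : 0 <= x -> x <= T -> `[0, T]%classic x.
  by move=> x0 xT; rewrite /= in_itv/= x0.
have X_var : pvle r (increment X) 0 T eps.
  exact: pvle_increment (ltW eps_gt0) (ltW X_eps) inI.
have X'_var : pvle r (increment X') 0 T eps.
  exact: pvle_increment (ltW eps_gt0) (ltW X'_eps) inI.
have psup x : mnorm (phi x) <= Phi0 by exact: supnorm_ub phi_sup.
have p'sup x : mnorm (phi' x) <= Phi0 by exact: supnorm_ub phi'_sup.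
have pholder x y : mnorm (phi x - phi y) <= Phia * enorm (x - y) `^ alpha.
  by apply: holder_ub phi_holder => //; rewrite mnorm0.
have p'holder x y : mnorm (phi' x - phi' y) <= Phia * enorm (x - y) `^ alpha.
  by apply: holder_ub phi'_holder => //; rewrite mnorm0.
have small : zeta (theta alpha r) * Phia * (2 * Phi0 * eps) `^ alpha <= Phi0.
  exact: smallness_variation small_sup.
have Y_var := solution_variation_bound alpha0 alpha1 r1 ralpha T0 Phi0_gt0
  (ltW Phia_gt0) eps_gt0 psup pholder small Ylim X_var.
have Y'_var := solution_variation_bound alpha0 alpha1 r1 ralpha T0 Phi0_gt0
  (ltW Phia_gt0) eps_gt0 p'sup p'holder small Y'lim X'_var.
have fin (x : \bar R) K : (0 <= x)%E -> (x <= K%:E)%E ->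
    exists2 y, 0 <= y & x = y%:E.
  by case: x => [y y_ge0 _|//|//]; exists y.
have [V V0 VE] : exists2 V, 0 <= V & pvar r (X \- X') `[0, T] = V%:E.
  apply: (fin _ (eps + eps)); first exact: pvar_ge0.
  apply: pvar_le => //; first by rewrite addr_ge0 ?ltW.
    exact: interval_is_interval.
  move=> a b /=; rewrite !in_itv/= => /andP[a0 _] /andP[_ bT] ab.
  apply: (@pvle_le _ _ (fun u v => increment X u v + increment X' u v)).
  - exact: ltW.
  - move=> u v _ _ _; rewrite increment_ge0 /= /increment.
    rewrite -[enorm (X' v - X' u)]enormN.
    have -> : (X \- X') v - (X \- X') u = (X v - X u) + - (X' v - X' u).
      by apply/matrixP => i j; rewrite !mxE; ring.
    exact: enormD.
  - have sX := pvle_sub a0 ab bT X_var; have sX' := pvle_sub a0 ab bT X'_var.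
    exact: (pvleD r1 (ltW eps_gt0) (ltW eps_gt0) (increment_ge0 _)
      (increment_ge0 _) sX sX').
have [S S0 SE] : exists2 S, 0 <= S & supnorm (@mnorm R d n) (phi \- phi') = S%:E.
  apply: (fin _ (Phi0 + Phi0)).
    apply: (@le_trans _ _ (mnorm ((phi \- phi') 0))%:E).
      by rewrite lee_fin mnorm_ge0.
    by apply: ereal_sup_ubound; exists 0.
  by apply: supnorm_le => x; rewrite (le_trans (ler_mnormB _ _))// lerD.
have [H H0 HE] : exists2 H, 0 <= H &
    holder (@mnorm R d n) alpha (phi \- phi') = H%:E.
  apply: (fin _ (Phia + Phia)).
    by apply: ereal_sup_ubound; exists (0, 0) => //=; rewrite subrr mnorm0 mul0r.
  apply: holder_le; first by rewrite addr_ge0 ?ltW.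
  move=> x y; rewrite mulrDl.
  have -> : (phi \- phi') x - (phi \- phi') y = (phi x - phi y) - (phi' x - phi' y).
    by apply/matrixP => i j; rewrite !mxE; ring.
  by rewrite (le_trans (ler_mnormB _ _))// lerD.
have DX_var : pvle r (increment (X \- X')) 0 T V.
  by apply: pvle_increment inI; rewrite ?VE.
have dsup x : mnorm (phi x - phi' x) <= S.
  by apply: (@supnorm_ub _ _ _ _ (phi \- phi')); rewrite SE.
have dholder x y :
    mnorm ((phi x - phi' x) - (phi y - phi' y)) <= H * enorm (x - y) `^ alpha.
  by apply: (@holder_ub _ _ _ _ _ (phi \- phi')); rewrite ?HE ?mnorm0.
have Dsup x u : mnorm ('d phi x u) <= Phi1 * enorm u by exact: mnorm_diff_le.
have Dholder x y u :
    mnorm ('d phi x u - 'd phi y u) <= L * enorm (x - y) `^ alpha * enorm u.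
  exact: mnorm_diffB_le.
have m_ge0 : 0 <= 2 * Phi0 * eps by rewrite !mulr_ge0 ?ltW.
exists (difference_rate alpha r Y Y' 0 T Phi1 L S H (2 * Phi0 * eps)); split.
  rewrite VE SE HE -!EFinM lee_fin.
  have -> : enorm (y0 - y0') = enorm ((Y \- Y') 0) by rewrite /= Y0 Y'0.
  rewrite (gtr0_norm Phia_gt0).
  apply: smallness_rate => //; first exact: enorm_ge0.
  apply: (difference_rate_bound alpha0 alpha1 r1 ralpha T0 Phi0_gt0 (ltW Phia_gt0)
    (ltW Phi1_gt0) (ltW L_gt0) S0 H0 eps_gt0 m_ge0 p'sup p'holder dphi Dsup
    Dholder dsup dholder Ylim Y'lim small X_var Y_var Y'_var V0 DX_var).
  exact: smallness_contraction.
move=> I itvI I0T.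
have sub (f : R -> 'cV[R]_n) K : (pvar r f `[0%R, T] <= K%:E)%E ->
    exists2 k, 0 <= k & pvar r f I = k%:E.
  move=> fK; apply: (fin _ K); first exact: pvar_ge0.
  exact: le_trans (le_pvar _ _ I0T) fK.
have [KX KX0 KXE] := sub X eps (ltW X_eps).
have [KD KD0 KDE] : exists2 k, 0 <= k & pvar r (X \- X') I = k%:E.
  by apply: (sub _ V); rewrite VE.
rewrite KXE KDE -!EFinM.
have g0 : 0 <= difference_rate alpha r Y Y' 0 T Phi1 L S H (2 * Phi0 * eps).
  by apply: difference_rate_ge0 => //; exact: ltW.
apply: pvar_le => //.
  by rewrite addr_ge0// !mulr_ge0// ltW.
move=> a b Ia Ib ab.
have abI x : a <= x -> x <= b -> I x by move=> ax xb; apply: (itvI a b) => //; rewrite ax.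
have /andP[a0 _] : 0 <= a <= T by have := I0T _ Ia; rewrite /= in_itv.
have /andP[_ bT] : 0 <= b <= T by have := I0T _ Ib; rewrite /= in_itv.
apply: (difference_variation_bound alpha0 alpha1 r1 ralpha T0 Phi0_gt0
  (ltW Phia_gt0) (ltW Phi1_gt0) (ltW L_gt0) S0 H0 m_ge0 p'sup p'holder dphi
  Dsup Dholder dsup dholder Ylim Y'lim small X_var Y_var Y'_var DX_var) => //.
- by apply: pvle_increment abI; rewrite ?KXE.
- by apply: pvle_increment abI; rewrite ?KDE.
Qed.
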